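(* Let $P$ be an Eulerian Sheffer poset with binomial factorial function $B(n) = n!$. Then the Sheffer factorial function $D(n)$ satisfies one of the following three alternatives: (i) $D(n) = 2\cdot(n-1)!$ for all $n\ge 2$; in this case every Sheffer $n$-interval is isomorphic to $\Sigma^*(B_{n-1})$; (ii) $D(n) = n!$ for all $n\ge1$; in this case $P$ is a binomial poset and every Sheffer $n$-interval is isomorphic to the Boolean algebra $B_n$; (iii) $D(n) = 2^{n-1}\cdot(n-1)!$ for all $n\ge1$; in this case, if a Sheffer $n$-interval $[\hat 0,y]$ is furthermore a lattice, then $[\hat0,y]$ is isomorphic to the cubical lattice $C_n$.
   Context: All posets are locally finite with a unique minimal element $\hat 0$. A Sheffer poset is such a poset $P$ that (i) contains an infinite chain, (ii) has every interval graded (rank function $\rho$, $\rho(\hat0)=0$; $[x,y]$ is an $n$-interval if $\rho(y)-\rho(x)=n$), (iii) any two $n$-intervals $[\hat0,y]$, $[\hat0,v]$ with $y,v\neq\hat0$ have the same number $D(n)$ of maximal chains, and (iv) any two $n$-intervals $[x,y]$, $[u,v]$ with $x,u\neq\hat0$ have the same number $B(n)$ of maximal chains. Intervals $[\hat0,y]$ are Sheffer intervals. A binomial poset is a poset satisfying (i), (ii) and in which any two $n$-intervals have the same number of maximal chains. A poset is Eulerian if $\mu(x,y)=(-1)^{\rho(y)-\rho(x)}$ for all $x\le y$. $B_n$ is the Boolean algebra of subsets of an $n$-set. For a poset $R$ with minimum $\hat0$, the dual suspension $\Sigma^*(R)$ is $R$ with two new elements $a_1,a_2$ added, with $\hat 0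 < a_i < y$ for all $y > \hat 0$ in $R$ and $i=1,2$. The cubical lattice $C_n$ is the face lattice of the $(n-1)$-dimensional cube (including the empty face), a lattice of rank $n$; equivalently $C_n = \Pi^{n-1}\cup\{\hat0\}$ where $\Pi$ is the three-element poset $\{0,1,*\}$ with $0,1<*$ and $\Pi^{n-1}$ has the componentwise order. *)

(* Defs.v *)
From HB Require Import structures.
From mathcomp Require Import all_boot all_order all_algebra finmap.
From mathcomp Require Import mathcomp_extra boolp classical_sets functions.
From mathcomp Require Import cardinality set_interval.

Set Implicit Arguments.
Unset Strict Implicit.
Unset Printing Implicit Defensive.

Import Order.TTheory GRing.Theory.

Local Open Scope classical_set_scope.
Local Open Scope order_scope.

Section LocallyFinitePosets.
Context {d : Order.disp_t} {P : bPOrderType d}.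
Implicit Types (x y z : P) (C : set P).

Definition locally_finite := forall x y : P, finite_set `[x, y].

Definition is_chain C := total_on C (fun a b => a <= b).

Definition has_infinite_chain := exists2 C, is_chain C & infinite_set C.

Definition max_chains x y : set (set P) :=
  [set C | [/\ C `<=` `[x, y], is_chain C &
     forall C', C' `<=` `[x, y] -> is_chain C' -> C `<=` C' -> C' = C]].

(* [fset_set A] is the finite set with the elements of [A] when [A] is finite,
   which is the case below in a locally finite poset. *)
Definition nb_max_chains x y : nat := #|` fset_set (max_chains x y)|%fset.

Definition chain_length C : nat := (#|` fset_set C|%fset).-1.

Definition graded_interval x y := forall C C',
  max_chains x y C -> max_chains x y C' -> chain_length C = chain_length C'.

Definition graded_intervals := forall x y : P, x <= y -> graded_interval x y.

(* When [[\bot, x]] is graded, all the maximal chains have the same length and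
   the maximum is this common length. *)
Definition rank x : nat :=
  (\max_(C <- fset_set (max_chains \bot x)) chain_length C)%N.

Definition n_interval (n : nat) x y := x <= y /\ (rank y - rank x)%N = n.

(* The first argument bounds the depth of the recursion; see [mobiusE]. *)
Fixpoint mobius_rec (k : nat) x y : int :=
  if k is k'.+1 then
    if x == y then 1%R
    else (- \sum_(z <- fset_set `[x, y[) mobius_rec k' x z)%R
  else 0%R.

Definition mobius x y : int := mobius_rec #|` fset_set `[x, y]|%fset x y.

Definition eulerian := forall x y : P,
  x <= y -> mobius x y = ((-1) ^+ (rank y - rank x)%N)%R.

Definition sheffer_poset :=
  [/\ locally_finite, has_infinite_chain, graded_intervals,
      forall (n : nat) (y v : P), y != \bot -> v != \bot ->
        n_interval n \bot y -> n_interval n \bot v ->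
        nb_max_chains \bot y = nb_max_chains \bot v
    & forall (n : nat) (x y u v : P), x != \bot -> u != \bot ->
        n_interval n x y -> n_interval n u v ->
        nb_max_chains x y = nb_max_chains u v].

Definition binomial_poset :=
  [/\ locally_finite, has_infinite_chain, graded_intervals
    & forall (n : nat) (x y u v : P),
        n_interval n x y -> n_interval n u v ->
        nb_max_chains x y = nb_max_chains u v].

Definition is_binomial_factorial (B : nat -> nat) := forall (n : nat) (x y : P),
  x != \bot -> n_interval n x y -> nb_max_chains x y = B n.

Definition is_sheffer_factorial (D : nat -> nat) := forall (n : nat) (y : P),
  y != \bot -> n_interval n \bot y -> nb_max_chains \bot y = D n.

Definition interval_iso x y {d' : Order.disp_t} (S : porderType d') :=
  exists2 f : S -> P, set_bij setT `[x, y] f & {mono f : a b / a <= b}.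

Definition interval_lattice x y :=
  forall a b : P, x <= a <= y -> x <= b <= y ->
  (exists2 j, x <= j <= y &
     forall z, x <= z <= y -> (j <= z) = (a <= z) && (b <= z)) /\
  (exists2 m, x <= m <= y &
     forall z, x <= z <= y -> (z <= m) = (z <= a) && (z <= b)).

Lemma card_itv_lt x y z : finite_set `[x, y] -> x <= z < y ->
  (#|` fset_set `[x, z]| < #|` fset_set `[x, y]|)%fset%N.
Proof.
move=> fxy /andP[xz zy].
have sub : `[x, z] `<=` `[x, y].
  by move=> t /=; rewrite !in_itv /= => /andP[-> /le_trans]; apply; exact: ltW.
have fxz : finite_set `[x, z] by exact: sub_finite_set fxy.
have yxy : y \in fset_set `[x, y].
  by rewrite in_fset_set// inE /= in_itv /= lexx andbT (le_trans xz (ltW zy)).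
apply: fproper_ltn_card; rewrite fproperE; apply/andP; split.
  by apply/fsubsetP => t; rewrite !in_fset_set// !inE => /sub.
apply/negP => /fsubsetP /(_ y yxy); rewrite in_fset_set// inE /= in_itv /=.
by move=> /andP[_ /(lt_le_trans zy)]; rewrite ltxx.
Qed.

Lemma mobius_recE (k : nat) x y : locally_finite ->
  (#|` fset_set `[x, y]| <= k)%fset%N -> mobius_rec k x y = mobius x y.
Proof.
move=> lf; rewrite /mobius.
have [n] := ubnP #|` fset_set `[x, y]|%fset.
elim: n k y => // n IH k y.
case E : #|` fset_set `[x, y]|%fset => [|m] lemn lek.
  suff -> : mobius_rec k x y = 0%R by [].
  have nxy : ~ x <= y.
    move=> xy; move/cardfs0_eq/fsetP/(_ x): E.
    rewrite in_fset_set// in_fset0 => /negP; apply.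
    by rewrite inE /= in_itv /= lexx.
  case: (k) => //= k'; case: eqVneq => [xy|_]; first by case: nxy; rewrite xy.
  rewrite (_ : `[x, y[%classic = set0); first by rewrite fset_set0 big_nil oppr0.
  rewrite -subset0 => z /=; rewrite in_itv /= => /andP[xz zy].
  by apply: nxy; exact: le_trans xz (ltW zy).
case: k lek => // k lek /=; case: eqVneq => // _; congr (- _)%R.
rewrite !big_seq; apply: eq_bigr => z.
have fco : finite_set `[x, y[.
  apply: sub_finite_set (lf x y) => t /=; rewrite !in_itv /=.
  by move=> /andP[-> /ltW].
rewrite in_fset_set// inE /= in_itv /= => xzy.
have := card_itv_lt (lf x y) xzy; rewrite E ltnS => lz.
rewrite !IH// ?(leq_trans lz)//; exact: leq_ltn_trans lz _.
Qed.

Lemma mobiusE x y : locally_finite -> mobius x y =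
  (if x == y then 1 else - \sum_(z <- fset_set `[x, y[) mobius x z)%R.
Proof.
move=> lf; rewrite -(mobius_recE lf (leqnSn _)) /=; case: eqVneq => // _.
congr (- _)%R; rewrite !big_seq; apply: eq_bigr => z.
have fco : finite_set `[x, y[.
  apply: sub_finite_set (lf x y) => t /=; rewrite !in_itv /=.
  by move=> /andP[-> /ltW].
rewrite in_fset_set// inE /= in_itv /= => xzy.
by apply: mobius_recE => //; exact/ltnW/card_itv_lt.
Qed.

End LocallyFinitePosets.

Arguments locally_finite {d} P.
Arguments has_infinite_chain {d} P.
Arguments graded_intervals {d} P.
Arguments eulerian {d} P.
Arguments sheffer_poset {d} P.
Arguments binomial_poset {d} P.
Arguments is_binomial_factorial {d} P B.
Arguments is_sheffer_factorial {d} P D.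

Definition dual_suspension {d : Order.disp_t} (R : bPOrderType d) : Type :=
  (R + bool)%type.

Section DualSuspension.
Context {d : Order.disp_t} {R : bPOrderType d}.

Definition dual_suspension_le (u v : dual_suspension R) : bool :=
  match u, v with
  | inl x, inl y => x <= y
  | inl x, inr _ => x == \bot
  | inr _, inl y => \bot < y
  | inr i, inr j => i == j
  end.

Fact dual_suspension_le_refl : reflexive dual_suspension_le.
Proof. by case=> /=. Qed.

Fact dual_suspension_le_anti : antisymmetric dual_suspension_le.
Proof.
move=> [x|i] [y|j] //=.
- by move/le_anti ->.
- by case/andP=> /eqP ->; rewrite ltxx.
- by case/andP=> yb /eqP y0; rewrite y0 ltxx in yb.
- by case/andP=> /eqP ->.
Qed.

Fact dual_suspension_le_trans : transitive dual_suspension_le.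
Proof.
move=> [y|j] [x|i] [z|k] //=.
- exact: le_trans.
- by move=> xy /eqP y0; rewrite y0 lex0 in xy.
- exact: lt_le_trans.
- by move=> yb /eqP y0; rewrite y0 ltxx in yb.
- by move=> /eqP ->; rewrite le0x.
- by move=> /eqP ->.
Qed.

HB.instance Definition _ := Choice.copy (dual_suspension R) (R + bool)%type.
HB.instance Definition _ := Order.Le_isPOrder.Build d (dual_suspension R)
  dual_suspension_le_refl dual_suspension_le_anti dual_suspension_le_trans.

End DualSuspension.

(* The outer [None] is the added minimum; in each coordinate [Some false],
   [Some true] and [None] are the elements 0, 1 and * of Pi. *)
Definition cubical_lattice (n : nat) : Type :=
  option {ffun 'I_n.-1 -> option bool}.

Fact cube_display : Order.disp_t. Proof. exact: Order.Disp tt tt. Qed.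

Section CubicalLattice.
Context {n : nat}.

Definition cube_coord_le (a b : option bool) : bool := (a == b) || (b == None).

Definition cubical_le (u v : cubical_lattice n) : bool :=
  match u, v with
  | None, _ => true
  | Some _, None => false
  | Some f, Some g => [forall i, cube_coord_le (f i) (g i)]
  end.

Fact cubical_le_refl : reflexive cubical_le.
Proof. by case=> //= f; apply/forallP => i; rewrite /cube_coord_le eqxx. Qed.

Fact cubical_le_anti : antisymmetric cubical_le.
Proof.
move=> [f|] [g|] //= /andP[/forallP fg /forallP gf]; congr Some.
apply/ffunP => i; move: (fg i) (gf i); rewrite /cube_coord_le.
by case: (f i) (g i) => [[]|] [[]|].
Qed.

Fact cubical_le_trans : transitive cubical_le.
Proof.
move=> [g|] [f|] [h|] //= /forallP fg /forallP gh; apply/forallP => i.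
move: (fg i) (gh i); rewrite /cube_coord_le.
by case: (f i) (g i) (h i) => [[]|] [[]|] [[]|].
Qed.

HB.instance Definition _ := Choice.copy (cubical_lattice n)
  (option {ffun 'I_n.-1 -> option bool}).
HB.instance Definition _ :=
  Order.Le_isPOrder.Build cube_display (cubical_lattice n)
  cubical_le_refl cubical_le_anti cubical_le_trans.

End CubicalLattice.

(* Main.v *)
Require Import Defs.
From mathcomp Require Import all_boot all_order.
From mathcomp Require Import all_algebra finmap zify ring lra.
From mathcomp Require Import boolp classical_sets functions cardinality.
From mathcomp Require Import set_interval.
Import Order.DefaultSetSubsetOrder.
Import Order.TTheory GRing.Theory Num.Theory.

Set Implicit Arguments.
Unset Strict Implicit.
Unset Printing Implicit Defensive.

(* Let [a n] be the number of atoms of a Sheffer [n]-interval, so that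
   [D n = a n * (n - 1)!].  Counting elements by rank, the Euler relation says
   that the sequence [v j = 1 / a (j + 1)] is a fixed point of the binomial
   transform; such a sequence is determined by its terms of even index, and
   [v 0 = 1], [v 1 = 1/2].  The fixed points [1, 1/2, 1/2, ...], [1 / (j + 1)]
   and [1 / 2 ^ j] correspond to the three alternatives.  Positivity and
   monotonicity of [v] leave finitely many values for each [v (2 m)]; as the
   upper intervals are Boolean, two coatoms share a multiple of [a (n - 2)]
   atoms, and counting incidences of atoms and coatoms leaves one value for
   [m > 1] and the values 1/2, 1/3, 1/4 for [v 2].
   For the isomorphisms, an element [z] other than the minimum is determined
   by the coatoms above it.  In the cubical case the lattice property makes
   exactly one coatom disjoint from a given one, so that the coatoms come in
   opposite pairs, which are the coordinates. *)

(** The interval above an atom is Boolean, so an [(N + 1)]-interval has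
    [a (N + 1) * 'C(N, j) / a (j + 1)] elements of rank [j + 1]; this is where the binomial
    transform of [v] comes from. For odd [N] the last term of the relation has sign -1, and
    [2 * v N] is expressed by earlier values. For even [N] the term [v N] cancels. The Euler
    relations alone therefore leave the number of atoms free at every odd rank and have many
    solutions besides the three wanted ones. The infinite chain supplies elements of every rank, so
    a wrong [v (2 m)] has consequences further up. Subtracting a model sequence from [v] isolates
    the first deviation, which by linearity determines the error at [2 m + 1]; there, or two indices
    later, positivity or monotonicity breaks down unless the deviation is small. The few small
    deviations that survive these estimates are excluded by the geometry of coatoms. All of this
    becomes effective only for [m > 1], which is why the choice between the alternatives is made at
    rank 3. *)

Section FsetCounting.
Context {K K' : choiceType}.
Implicit Types (A : {fset K}) (B : {fset K'}).

Lemma card_fsetM A B : #|` (A `*` B)%fset| = #|` A| * #|` B|.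
Proof.
rewrite (perm_size (enum_imfset2 _ _)) => [|[a b] [a' b'] _ _ [-> ->]//].
by rewrite size_allpairs.
Qed.

Lemma in_fset_filter A (p : pred K) x :
  (x \in [fset y in A | p y]%fset) = (x \in A) && p x.
Proof. by rewrite !inE. Qed.

Lemma card_fset_filter A (p : pred K) :
  #|` [fset x in A | p x]%fset| = \sum_(x <- A) p x.
Proof.
by rewrite card_fset_sum1 big_fset big_mkcond; apply: eq_bigr => x _; case: p.
Qed.

Lemma double_count A B (r : K -> K' -> bool) :
  \sum_(x <- A) #|` [fset y in B | r x y]%fset| =
  \sum_(y <- B) \sum_(x <- A) r x y.
Proof.
rewrite exchange_big /=; apply: eq_bigr => x _.
by rewrite card_fset_sum1 big_fset big_mkcond; apply: eq_bigr => y _; case: r.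
Qed.

Lemma sum_fset_const A (F : K -> nat) c :
  (forall x, x \in A -> F x = c) -> \sum_(x <- A) F x = #|` A| * c.
Proof.
move=> FE; rewrite big_seq (eq_bigr (fun=> c)); last by move=> x /FE.
by rewrite -big_seq big_const_seq count_predT iter_addn_0 mulnC.
Qed.

Lemma fset_eqEcard A1 A2 :
  (A1 `<=` A2)%fset -> #|` A2| <= #|` A1| -> A1 = A2.
Proof. by move=> s12 le21; apply/eqP; rewrite eqEfcard s12. Qed.

End FsetCounting.

(** * Maximal chains and ranks *)

Section Chains.
Context {d : Order.disp_t} {P : bPOrderType d}.
Implicit Types (x y z : P) (C : set P).
Local Open Scope order_scope.
Local Open Scope classical_set_scope.

Lemma in_itvE x y z : `[x, y]%classic z <-> x <= z <= y.
Proof. by rewrite /= in_itv. Qed.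

Hypothesis lf : locally_finite P.

Definition itv x y : {fset P} := fset_set `[x, y].

Lemma in_fitv x y z : (z \in itv x y) = (x <= z <= y).
Proof. by rewrite in_fset_set//; apply/idP/idP; rewrite inE /= in_itv. Qed.

Lemma finite_chain x y C : C `<=` `[x, y] -> finite_set C.
Proof. by move=> /sub_finite_set; apply. Qed.

Lemma finite_max_chains x y : finite_set (max_chains x y).
Proof.
apply: (@sub_finite_set _ _
  ((fun A : {fset P} => [set` A]) @` [set` fpowerset (itv x y)])); last first.
  by apply: finite_image; exact: finite_fset.
move=> C [CI _ _]; exists (fset_set C).
  by rewrite /= fpowersetE -fset_set_sub//; exact: finite_chain CI.
by rewrite fset_setK//; exact: finite_chain CI.
Qed.

Lemma is_chainS C C' : C `<=` C' -> is_chain C' -> is_chain C.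
Proof. by move=> CC' cC' a b /CC' Ca /CC' Cb; exact: cC'. Qed.

Lemma max_chain_extend x y C : C `<=` `[x, y] -> is_chain C ->
  exists2 C', max_chains x y C' & C `<=` C'.
Proof.
have [n] := ubnP (#|` itv x y| - #|` fset_set C|)%N.
elim: n C => // n IH C ltn CI cC.
have [mC|] := pselect (forall C', C' `<=` `[x, y] -> is_chain C' ->
  C `<=` C' -> C' = C); first by exists C.
move/existsNP => [C' /not_implyP[CI' /not_implyP[cC' /not_implyP[CC' neC]]]].
have ltC : (#|` fset_set C| < #|` fset_set C'|)%N.
  apply: fproper_ltn_card; rewrite fproperE.
  have [fC fC'] := (finite_chain CI, finite_chain CI').
  apply/andP; split; [by rewrite -fset_set_sub|apply/negP].
  by rewrite -fset_set_sub// => C'C; apply: neC; apply/seteqP.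
have leC' : (#|` fset_set C'| <= #|` itv x y|)%N.
  by apply: fsubset_leq_card; rewrite -fset_set_sub//; exact: finite_chain CI'.
have [||//|D mD C'D] := IH C'.
- by move: ltn; rewrite !ltnS; lia.
- exact: CI'.
by exists D => //; exact: subset_trans C'D.
Qed.

(** Adding [z] to [C] would give a larger chain. The maximality of cut and of glued chains is
    reduced to this criterion. *)
Lemma max_chain_mem x y z C : max_chains x y C -> x <= z <= y ->
  (forall w, C w -> w <= z \/ z <= w) -> C z.
Proof.
move=> [CI cC mC] zI comp.
suff <- : C `|` [set z] = C by right.
apply: mC => [w [/CI//|->]|a b [Ca|->] [Cb|->]|w]; last by left.
- exact/in_itvE.
- exact: cC.
- exact: comp.
- by apply/or_comm; exact: comp.
- by left.
Qed.

Lemma max_chain_ends x y C : x <= y -> max_chains x y C -> C x /\ C y.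
Proof.
move=> xy mC; have [CI _ _] := mC.
split; apply: max_chain_mem mC _ _; rewrite ?lexx ?xy// => w /CI/in_itvE.
  by case/andP=> ->; right.
by case/andP=> _ ->; left.
Qed.

Lemma max_chains_exist x y : max_chains x y !=set0.
Proof.
have [|a b []|C mC _] := @max_chain_extend x y set0; first exact: sub0set.
by exists C.
Qed.

Lemma max_chain_low x y z C : max_chains x y C -> C z ->
  max_chains x z (C `&` `[x, z]).
Proof.
move=> mC Cz; have [CI cC _] := mC.
have /andP[xz zy] : x <= z <= y by exact/in_itvE/CI.
split; [by move=> w []|exact: is_chainS cC|].
move=> C' CI' cC' CC'.
have C'z : C' z by apply: CC'; split=> //; apply/in_itvE; rewrite xz lexx.
apply/seteqP; split=> // w C'w; split; last exact: CI'.
have /andP[xw wz] : x <= w <= z by exact/in_itvE/CI'.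
apply: max_chain_mem mC _ _; first by rewrite xw (le_trans wz).
move=> v Cv; have [vz|zv] := cC _ _ Cv Cz; last first.
  by right; exact: le_trans zv.
apply: cC' => //; apply: CC'; split=> //; apply/in_itvE; rewrite vz andbT.
by have /in_itvE/andP[] := CI _ Cv.
Qed.

Lemma max_chain_up x y z C : max_chains x y C -> C z ->
  max_chains z y (C `&` `[z, y]).
Proof.
move=> mC Cz; have [CI cC _] := mC.
have /andP[xz zy] : x <= z <= y by exact/in_itvE/CI.
split; [by move=> w []|exact: is_chainS cC|].
move=> C' CI' cC' CC'.
have C'z : C' z by apply: CC'; split=> //; apply/in_itvE; rewrite zy lexx.
apply/seteqP; split=> // w C'w; split; last exact: CI'.
have /andP[zw wy] : z <= w <= y by exact/in_itvE/CI'.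
apply: max_chain_mem mC _ _; first by rewrite wy (le_trans xz).
move=> v Cv; have [vz|zv] := cC _ _ Cv Cz.
  by left; exact: le_trans zw.
apply: cC' => //; apply: CC'; split=> //; apply/in_itvE; rewrite zv /=.
by have /in_itvE/andP[] := CI _ Cv.
Qed.

Lemma max_chain_split x y z C : max_chains x y C -> C z ->
  (C `&` `[x, z]) `|` (C `&` `[z, y]) = C.
Proof.
move=> [CI cC _] Cz; apply/seteqP; split=> [w [[]|[]]//|w Cw].
have /in_itvE/andP[xw wy] := CI _ Cw.
have [wz|zw] := cC _ _ Cw Cz; [left|right]; split=> //; apply/in_itvE.
  by rewrite xw.
by rewrite zw.
Qed.

(** With [max_chain_catr], this recovers both pieces from their union, so that gluing at [z] is
    injective. *)
Lemma max_chain_catl x y z C1 C2 : x <= z <= y ->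
  max_chains x z C1 -> max_chains z y C2 -> (C1 `|` C2) `&` `[x, z] = C1.
Proof.
move=> /andP[xz zy] m1 [CI2 _ _]; have [CI1 _ _] := m1.
apply/seteqP; split=> [w [[//|C2w] /in_itvE/andP[_ wz]]|w C1w]; last first.
  by split; [left|exact: CI1].
have /in_itvE/andP[zw _] := CI2 _ C2w.
have -> : w = z by apply/le_anti; rewrite wz.
by have [] := max_chain_ends xz m1.
Qed.

Lemma max_chain_catr x y z C1 C2 : x <= z <= y ->
  max_chains x z C1 -> max_chains z y C2 -> (C1 `|` C2) `&` `[z, y] = C2.
Proof.
move=> /andP[xz zy] [CI1 _ _] m2; have [CI2 _ _] := m2.
apply/seteqP; split=> [w [[C1w|//] /in_itvE/andP[zw _]]|w C2w]; last first.
  by split; [right|exact: CI2].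
have /in_itvE/andP[_ wz] := CI1 _ C1w.
have -> : w = z by apply/le_anti; rewrite wz.
by have [] := max_chain_ends zy m2.
Qed.

Lemma max_chain_cat x y z C1 C2 : x <= z <= y ->
  max_chains x z C1 -> max_chains z y C2 -> max_chains x y (C1 `|` C2).
Proof.
move=> /andP[xz zy] m1 m2.
have [CI1 cC1 M1] := m1; have [CI2 cC2 M2] := m2.
have [C1x C1z] := max_chain_ends xz m1; have [C2z C2y] := max_chain_ends zy m2.
split.
- move=> w [/CI1|/CI2] /in_itvE/andP[a b]; apply/in_itvE.
    by rewrite a (le_trans b).
  by rewrite b andbT (le_trans xz).
- move=> a b [C1a|C2a] [C1b|C2b]; [exact: cC1|..|exact: cC2].
    have /in_itvE/andP[_ az] := CI1 _ C1a; have /in_itvE/andP[zb _] := CI2 _ C2b.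
    by left; exact: le_trans zb.
  have /in_itvE/andP[za _] := CI2 _ C2a; have /in_itvE/andP[_ bz] := CI1 _ C1b.
  by right; exact: le_trans za.
move=> C' CI' cC' sub; apply/seteqP; split=> // w C'w.
have /in_itvE/andP[xw wy] := CI' _ C'w.
have C'z : C' z by apply: sub; left.
have [wz|zw] := cC' _ _ C'w C'z.
  left; apply: max_chain_mem m1 _ _; first by rewrite xw.
  by move=> v C1v; apply: cC' => //; apply: sub; left.
right; apply: max_chain_mem m2 _ _; first by rewrite zw.
by move=> v C2v; apply: cC' => //; apply: sub; right.
Qed.

Lemma chain_length_cat x y z C1 C2 : x <= z <= y ->
  max_chains x z C1 -> max_chains z y C2 ->
  chain_length (C1 `|` C2) = (chain_length C1 + chain_length C2)%N.
Proof.
move=> /andP[xz zy] m1 m2.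
have [CI1 cC1 M1] := m1; have [CI2 cC2 M2] := m2.
have [C1x C1z] := max_chain_ends xz m1; have [C2z C2y] := max_chain_ends zy m2.
have f1 := finite_chain CI1; have f2 := finite_chain CI2.
have pos C : C z -> finite_set C -> (0 < #|` fset_set C|)%N.
  by move=> Cz fC; rewrite cardfs_gt0; apply/fset0Pn; exists z;
     rewrite in_fset_set// inE.
have p1 := pos _ C1z f1; have p2 := pos _ C2z f2.
rewrite /chain_length fset_setU// cardfsU.
suff -> : (fset_set C1 `&` fset_set C2 = [fset z])%fset.
  by rewrite cardfs1; lia.
apply/fsetP => w; rewrite !inE !in_fset_set//; apply/andP/eqP.
  move=> []; rewrite !inE => /CI1/in_itvE/andP[_ wz] /CI2/in_itvE/andP[zw _].
  by apply/le_anti; rewrite wz.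
by move=> ->; rewrite !inE.
Qed.

Lemma nb_max_chains_refl x : nb_max_chains x x = 1%N.
Proof.
rewrite /nb_max_chains (_ : max_chains x x = [set [set x]]).
  by rewrite fset_set1 cardfs1.
apply/seteqP; split=> C.
  move=> mC; have [Cx _] := max_chain_ends (lexx x) mC.
  have [CI _ _] := mC; apply/seteqP; split=> [w /CI/in_itvE|w ->//].
  by move=> /andP[xw wx]; apply/le_anti; rewrite xw wx.
move=> ->; split=> [w ->|a b -> ->|C' CI' _ sub].
- by apply/in_itvE; rewrite lexx.
- by left.
apply/seteqP; split=> // w /CI'/in_itvE/andP[xw wx].
by apply/le_anti; rewrite xw wx.
Qed.

Lemma nb_max_chains_gt0 x y : (0 < nb_max_chains x y)%N.
Proof.
have [C mC] := max_chains_exist x y.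
rewrite cardfs_gt0; apply/fset0Pn; exists C.
by rewrite in_fset_set ?inE//; exact: finite_max_chains.
Qed.

(** Cutting at [z] and taking unions are inverse bijections between the maximal chains through [z]
    and the pairs of maximal chains below and above it. *)
Lemma card_max_chains_through x y z : x <= z <= y ->
  #|` [fset C in fset_set (max_chains x y) | `[< C z >]]%fset|%fset =
  (nb_max_chains x z * nb_max_chains z y)%N.
Proof.
move=> xzy; rewrite /nb_max_chains -card_fsetM.
have fin := finite_max_chains.
pose U (p : set P * set P) := p.1 `|` p.2.
have Uinj : {in fset_set (max_chains x z) `*` fset_set (max_chains z y) &,
    injective U}%fset.
  move=> [C1 C2] [D1 D2]; rewrite !in_fsetM /= !in_fset_set//.
  move=> /andP[/set_mem c1 /set_mem c2] /andP[/set_mem d1 /set_mem d2] UE.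
  congr pair.
    by rewrite -(max_chain_catl xzy c1 c2) -(max_chain_catl xzy d1 d2) -/(U (_, _)) UE.
  by rewrite -(max_chain_catr xzy c1 c2) -(max_chain_catr xzy d1 d2) -/(U (_, _)) UE.
rewrite -(card_in_imfset imfset_key Uinj); congr (#|` _|)%fset; apply/fsetP => C.
apply/idP/idP.
  rewrite !inE /= in_fset_set// => /andP[/set_mem mC /asboolP Cz].
  apply/imfsetP; exists (C `&` `[x, z], C `&` `[z, y]) => /=.
    rewrite in_fsetM /= !in_fset_set//.
    apply/andP; split; apply/mem_set; first exact: max_chain_low mC Cz.
    exact: max_chain_up mC Cz.
  by rewrite /U /= (max_chain_split mC).
move=> /imfsetP[[C1 C2] /=]; rewrite in_fsetM /= !in_fset_set//.
move=> /andP[/set_mem m1 /set_mem m2] ->.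
rewrite !inE /= in_fset_set//; apply/andP; split.
  by apply/mem_set; exact: max_chain_cat xzy m1 m2.
apply/asboolP; left; have /andP[xz _] := xzy.
by have [] := max_chain_ends xz m1.
Qed.

End Chains.

(** * Ranks, levels and counting chains by level *)

Section Ranks.
Context {d : Order.disp_t} {P : bPOrderType d}.
Implicit Types (x y z : P) (C : set P).
Local Open Scope order_scope.
Local Open Scope classical_set_scope.

Hypotheses (lf : locally_finite P) (gr : graded_intervals P).

Lemma rank_chain_length x C : max_chains \bot x C -> rank x = chain_length C.
Proof.
move=> mC; have fin := finite_max_chains lf \bot x.
have eqC C' : C' \in fset_set (max_chains \bot x) ->
    chain_length C' = chain_length C.
  rewrite in_fset_set// => /set_mem mC'.
  by apply: gr mC' mC; exact: le0x.
apply/eqP; rewrite eqn_leq; apply/andP; split.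
  by apply/bigmax_leqP_seq => C' /eqC ->.
by apply: leq_bigmax_seq => //; rewrite in_fset_set//; exact/mem_set.
Qed.

(** A maximal chain of [[\bot, x]] prolonged by [C] is a maximal chain of [[\bot, y]], and all of
    those have the same length. *)
Lemma rank_add x y C : x <= y -> max_chains x y C ->
  rank y = (rank x + chain_length C)%N.
Proof.
move=> xy mC; have [C0 mC0] := max_chains_exist lf \bot x.
have I : \bot <= x <= y by rewrite le0x.
rewrite (rank_chain_length (max_chain_cat I mC0 mC)).
by rewrite (chain_length_cat lf I mC0 mC) -(rank_chain_length mC0).
Qed.

Lemma rank_bot : rank (\bot : P) = 0%N.
Proof.
have [C mC] := max_chains_exist lf (\bot : P) \bot.
by have := rank_add (lexx _) mC; rewrite -(rank_chain_length mC); lia.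
Qed.

Lemma rank_lt x y : x < y -> (rank x < rank y)%N.
Proof.
move=> xy; have [C mC] := max_chains_exist lf x y.
rewrite (rank_add (ltW xy) mC) -addn1 leq_add2l /chain_length.
have [Cx Cy] := max_chain_ends (ltW xy) mC.
have [CI _ _] := mC; have fC := finite_chain lf CI.
suff : (#|` [fset x; y]%fset| <= #|` fset_set C|)%N.
  by rewrite cardfs2 (lt_eqF xy)/=; lia.
apply: fsubset_leq_card; apply/fsubsetP => w.
by rewrite !inE in_fset_set// => /orP[]/eqP ->; exact/mem_set.
Qed.

Lemma rank_le x y : x <= y -> (rank x <= rank y)%N.
Proof. by rewrite le_eqVlt => /orP[/eqP->//|/rank_lt/ltnW]. Qed.

Lemma rank_inj x y : x <= y -> (rank y <= rank x)%N -> x = y.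
Proof. by rewrite le_eqVlt => /orP[/eqP//|/rank_lt]; lia. Qed.

Lemma rank_eq0 x : (rank x == 0%N) = (x == \bot).
Proof.
apply/eqP/eqP => [r0|->]; last exact: rank_bot.
by apply/esym/rank_inj; rewrite ?le0x// rank_bot r0.
Qed.

(** The ranks along [C] are distinct, lie between [rank x] and [rank y], and are as many as the
    integers in that range; hence every value is attained. *)
Lemma max_chain_rank_ex x y C r : x <= y -> max_chains x y C ->
  (rank x <= r <= rank y)%N -> exists2 z, C z & rank z = r.
Proof.
move=> xy mC rI; have [CI cC _] := mC; have fC := finite_chain lf CI.
have [Cx _] := max_chain_ends xy mC.
pose s := [seq rank z | z <- fset_set C].
have us : uniq s.
  rewrite map_inj_in_uniq ?fset_uniq// => z w.
  rewrite !in_fset_set// => /set_mem Cz /set_mem Cw zw.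
  have [] := cC _ _ Cz Cw => [/rank_inj->//|/rank_inj->//]; rewrite zw//.
have sub : {subset s <= iota (rank x) (chain_length C).+1}.
  move=> _ /mapP[z + ->]; rewrite in_fset_set// => /set_mem Cz.
  rewrite mem_iota addnS -(rank_add xy mC) ltnS.
  by have /in_itvE/andP[xz zy] := CI _ Cz; rewrite !rank_le.
have size_s : (size (iota (rank x) (chain_length C).+1) <= size s)%N.
  rewrite size_iota size_map /chain_length prednK// cardfs_gt0.
  by apply/fset0Pn; exists x; rewrite in_fset_set//; exact/mem_set.
have [_ /(_ r)] := uniq_min_size us sub size_s.
rewrite mem_iota addnS -(rank_add xy mC) ltnS rI => /mapP[z].
by rewrite in_fset_set// => /set_mem Cz ->; exists z.
Qed.

Definition level x y (r : nat) : {fset P} := [fset z in itv x y | rank z == r]%fset.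

Lemma in_level x y r z :
  (z \in level x y r) = (x <= z <= y) && (rank z == r).
Proof. by rewrite !inE /= in_fitv. Qed.

(** Every maximal chain meets the level [r] in exactly one element. *)
Lemma nb_max_chains_level x y r : x <= y -> (rank x <= r <= rank y)%N ->
  nb_max_chains x y =
  (\sum_(z <- level x y r) nb_max_chains x z * nb_max_chains z y)%N.
Proof.
move=> xy rI; have fin := finite_max_chains lf x y.
under [RHS]eq_big_seq => z.
  rewrite in_level => /andP[xzy _].
  rewrite -(card_max_chains_through lf xzy); over.
rewrite (double_count _ _ (fun z C => `[< C z >])).
rewrite (@sum_fset_const _ _ _ 1%N) ?muln1// => C.
rewrite in_fset_set// => /set_mem mC; have [CI cC _] := mC.
have [z Cz rz] := max_chain_rank_ex xy mC rI.
have zl : z \in level x y r by rewrite in_level rz eqxx andbT; exact/in_itvE/CI.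
rewrite (big_fsetD1 z)//= asboolT// big1_seq ?addn0// => w /=.
rewrite in_fsetD1 in_level => /and3P[wz _ /eqP rw].
case: asboolP => // Cw; case/eqP: wz.
by have [/rank_inj|/rank_inj] := cC _ _ Cw Cz => ->//; rewrite rw rz.
Qed.

Lemma level_ex x y r : x <= y -> (rank x <= r <= rank y)%N ->
  exists2 z, x <= z <= y & rank z = r.
Proof.
move=> xy rI; have [C mC] := max_chains_exist lf x y.
have [z Cz rz] := max_chain_rank_ex xy mC rI; exists z => //.
by have [CI _ _] := mC; exact/in_itvE/CI.
Qed.

(** The elements of a chain have distinct ranks, so an infinite chain has unbounded ranks, and the
    smaller ranks occur below its elements. *)
Lemma rank_surj (r : nat) : has_infinite_chain P -> exists y : P, rank y = r.
Proof.
move=> [C cC infC].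
suff [y Cy ry] : exists2 y, C y & (r <= rank y)%N.
  have [|z _ rz] := @level_ex \bot y r (le0x y); last by exists z.
  by rewrite rank_bot.
apply: contrapT => noy.
have bnd y : C y -> (rank y < r)%N.
  by move=> Cy; rewrite ltnNge; apply/negP => ry; apply: noy; exists y.
have [X XC leX] := infinite_set_fset r.+1 infC.
suff : (#|` X| <= r)%N by rewrite leqNgt leX.
rewrite -(size_iota 0 r) -(size_map (rank (P := P))); apply: uniq_leq_size.
  rewrite map_inj_in_uniq ?fset_uniq// => z w /XC Cz /XC Cw zw.
  have [/rank_inj->|/rank_inj->] := cC _ _ Cz Cw => //; by rewrite zw.
by move=> _ /mapP[z /XC/bnd ltz ->]; rewrite mem_iota.
Qed.

End Ranks.

(** * Intervals with factorially many maximal chains are Boolean *)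

Section FactorialIntervals.
Context {d : Order.disp_t} {P : bPOrderType d}.
Implicit Types (x y z u p c s t : P).
Local Open Scope order_scope.

Hypotheses (lf : locally_finite P) (gr : graded_intervals P).

Definition atoms x y : {fset P} := level x y (rank x).+1.

Definition coatoms x y : {fset P} :=
  [fset z in itv x y | (rank z).+1 == rank y]%fset.

Lemma in_coatoms x y z :
  (z \in coatoms x y) = (x <= z <= y) && ((rank z).+1 == rank y).
Proof. by rewrite !inE /= in_fitv. Qed.

Lemma in_atoms x y z :
  (z \in atoms x y) = (x <= z <= y) && (rank z == (rank x).+1).
Proof. exact: in_level. Qed.

Lemma coatomsE x y : x < y -> coatoms x y = level x y (rank y).-1.
Proof.
move=> /(rank_lt lf gr) xy; apply/fsetP => z; rewrite in_coatoms in_level//.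
by congr (_ && _); apply/eqP/eqP; lia.
Qed.

Lemma coatoms_anti x z y : x <= z -> (coatoms z y `<=` coatoms x y)%fset.
Proof.
move=> xz; apply/fsubsetP => c; rewrite !in_coatoms => /andP[/andP[zc ->] ->].
by rewrite (le_trans xz zc).
Qed.

Lemma atoms_mono x z y : z <= y -> (atoms x z `<=` atoms x y)%fset.
Proof.
move=> zy; apply/fsubsetP => p; rewrite !in_atoms => /andP[/andP[-> pz] ->].
by rewrite (le_trans pz zy).
Qed.

(** Required of all subintervals at once, so that inductions can pass to a smaller interval. *)
Definition factorial_interval x y := forall s t, x <= s -> s <= t -> t <= y ->
  nb_max_chains s t = (rank t - rank s)`!.

Lemma factorial_intervalS x y s t : factorial_interval x y ->
  x <= s -> t <= y -> factorial_interval s t.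
Proof.
move=> fxy xs ty u v su uv vt.
by apply: fxy => //; [exact: le_trans su|exact: le_trans ty].
Qed.

Lemma card_level_factorial x y r : factorial_interval x y -> x <= y ->
  (rank x <= r <= rank y)%N ->
  (#|` level x y r| * ((r - rank x)`! * (rank y - r)`!) =
    (rank y - rank x)`!)%N.
Proof.
move=> fxy xy rI; rewrite -(fxy x y)// (nb_max_chains_level lf gr xy rI).
apply/esym/sum_fset_const => z; rewrite in_level// => /andP[/andP[xz zy] /eqP <-].
by rewrite !fxy.
Qed.

Lemma card_atoms_factorial x y : factorial_interval x y -> x <= y ->
  #|` atoms x y| = (rank y - rank x)%N.
Proof.
move=> fxy; rewrite le_eqVlt => /orP[/eqP <-|xy].
  rewrite subnn; apply/eqP; rewrite cardfs_eq0; apply/eqP/fsetP => z.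
  by rewrite in_atoms inE; apply/negP => /andP[/le_anti <- /eqP]; lia.
have rxy := rank_lt lf gr xy.
have := @card_level_factorial x y (rank x).+1 fxy (ltW xy).
rewrite leqnSn rxy => /(_ isT).
have -> : (rank y - rank x = (rank y - (rank x).+1).+1)%N by lia.
rewrite subSn// subnn mul1n factS => /eqP.
by rewrite eqn_pmul2r ?fact_gt0// => /eqP.
Qed.

Lemma card_coatoms_factorial x y : factorial_interval x y -> x <= y ->
  #|` coatoms x y| = (rank y - rank x)%N.
Proof.
move=> fxy; rewrite le_eqVlt => /orP[/eqP <-|xy].
  rewrite subnn; apply/eqP; rewrite cardfs_eq0; apply/eqP/fsetP => z.
  by rewrite in_coatoms inE; apply/negP => /andP[/le_anti <- /eqP]; lia.
have rxy := rank_lt lf gr xy; rewrite coatomsE//.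
have := @card_level_factorial x y (rank y).-1 fxy (ltW xy).
have -> : (rank x <= (rank y).-1 <= rank y)%N by lia.
have -> : (rank y - rank x = ((rank y).-1 - rank x).+1)%N by lia.
have -> : (rank y - (rank y).-1 = 1)%N by lia.
move=> /(_ isT); rewrite muln1 factS => /eqP.
by rewrite eqn_pmul2r ?fact_gt0// => /eqP.
Qed.

(** If [S] misses a coatom [c], some atom [p] is not below [c], since [[x, c]] has fewer atoms than
    [[x, y]]. By counting, the coatoms of [[p, y]] are all the coatoms but [c], and induction
    applies to [[p, y]]. *)
Lemma coatoms_surj x y (S : {fset P}) : factorial_interval x y -> x <= y ->
  (S `<=` coatoms x y)%fset -> exists2 z, x <= z <= y & coatoms z y = S.
Proof.
have [n] := ubnP (rank y - rank x)%N.
elim: n x => // n IH x ltn fxy xy SE.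
have [CS|/fsubsetPn[c cC cS]] := boolP (coatoms x y `<=` S)%fset.
  by exists x; rewrite ?lexx ?xy//; apply/eqP; rewrite eqEfsubset CS.
have := cC; rewrite in_coatoms => /andP[/andP[xc cy] /eqP rc].
have rxc := rank_le lf gr xc.
have [p pA pc] : exists2 p, p \in atoms x y & ~~ (p <= c).
  have /fsubsetPn[p pA pc] : ~~ (atoms x y `<=` atoms x c)%fset.
    apply/negP => /fsubset_leq_card.
    rewrite !card_atoms_factorial//; last exact: factorial_intervalS fxy _ _.
    by lia.
  exists p => //; apply: contra pc => pc; move: pA.
  by rewrite !in_atoms pc => /andP[/andP[-> _] ->].
move: (pA); rewrite in_atoms => /andP[/andP[xp py] /eqP rp].
have fpy := factorial_intervalS fxy xp (lexx y).
have Cp : coatoms p y = (coatoms x y `\ c)%fset.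
  apply: fset_eqEcard.
    apply/fsubsetP => c' c'p; rewrite in_fsetD1 (fsubsetP (coatoms_anti y xp))//.
    rewrite andbT; apply/eqP => cc'; move: c'p; rewrite cc' in_coatoms.
    by rewrite (negPf pc).
  have := cardfsD1 c (coatoms x y); rewrite cC !card_coatoms_factorial// rp; clear; lia.
have [||z /andP[pz zy] Cz] := IH p _ fpy py.
- by move: rxc rc ltn; rewrite rp; clear; lia.
- rewrite Cp; apply/fsubsetP => w wS; rewrite in_fsetD1 (fsubsetP SE)// andbT.
  by apply: contraNneq cS => <-.
by exists z => //; rewrite zy (le_trans xp).
Qed.

Lemma coatoms_sub_le x y z z' : factorial_interval x y ->
  x <= z <= y -> x <= z' <= y -> (coatoms z' y `<=` coatoms z y)%fset -> z <= z'.
Proof.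
have [n] := ubnP (rank y - rank x)%N.
elim: n x => // n IH x ltn fxy /andP[xz zy] /andP[xz' z'y] sub.
have xy := le_trans xz zy.
move: xz; rewrite le_eqVlt => /orP[/eqP<-//|xz].
have [p] : exists p, p \in atoms x z.
  apply/fset0Pn; rewrite -cardfs_gt0.
  rewrite card_atoms_factorial ?subn_gt0 ?(rank_lt lf gr)// ?ltW//.
  exact: factorial_intervalS fxy _ _.
rewrite in_atoms => /andP[/andP[xp pz] /eqP rp].
have fpy := factorial_intervalS fxy xp (lexx y); have py := le_trans pz zy.
have rpy := rank_le lf gr py.
suff pz' : p <= z' by apply: (IH p); rewrite ?pz ?pz'//;
  move: ltn rp rpy; clear; lia.
(* Each coatom misses exactly one atom and each atom exactly one coatom, so
   counting the missing incidences shows that the atoms of [z'] are exactly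
   those below all the coatoms above [z']. *)
pose X := [fset q in atoms x y | ~~ (coatoms z' y `<=` coatoms q y)]%fset.
have cardX : (rank y - rank z' <= #|` X|)%N.
  rewrite -card_coatoms_factorial//; last exact: factorial_intervalS fxy _ _.
  have <- : (\sum_(c <- coatoms z' y)
      #|` [fset q in atoms x y | ~~ (q <= c)%O]%fset| = #|` coatoms z' y|)%N.
    rewrite (@sum_fset_const _ _ _ 1%N) ?muln1// => c cz'.
    have := fsubsetP (coatoms_anti y xz') _ cz'.
    rewrite in_coatoms => /andP[/andP[xc cy] /eqP rc].
    have -> : [fset q in atoms x y | ~~ (q <= c)%O]%fset =
        (atoms x y `\` atoms x c)%fset.
      apply/fsetP => q; rewrite in_fset_filter in_fsetD !in_atoms.
      have [qc|_] /= := boolP (q <= c); last by rewrite !andbF andbT.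
      by rewrite (le_trans qc cy) !andbT andbF andNb.
    rewrite cardfsDS ?atoms_mono// !card_atoms_factorial//.
      by have := rank_le lf gr xc; move: rc; clear; lia.
    exact: factorial_intervalS fxy _ _.
  rewrite (double_count _ _ (fun c q => ~~ (q <= c)%O)) card_fset_filter.
  rewrite big_seq [leqRHS]big_seq; apply: leq_sum => q.
  rewrite in_atoms => /andP[/andP[xq qy] /eqP rq].
  rewrite -card_fset_filter.
  have sub1 : ([fset c in coatoms z' y | ~~ (q <= c)%O] `<=`
      coatoms x y `\` coatoms q y)%fset.
    apply/fsubsetP => c; rewrite in_fset_filter in_fsetD !in_coatoms.
    move=> /andP[/andP[/andP[z'c ->] ->] /negPf ->].
    by rewrite (le_trans xz' z'c).
  have [sub2|_ /=] := boolP (coatoms z' y `<=` _)%fset.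
    rewrite leqn0 cardfs_eq0; apply/eqP/fsetP => c; rewrite in_fset_filter inE.
    apply/negP => /andP[/(fsubsetP sub2)].
    by rewrite in_coatoms => /andP[/andP[->]].
  apply: leq_trans (fsubset_leq_card sub1) _.
  have fqy := factorial_intervalS fxy xq (lexx y).
  by rewrite cardfsDS ?coatoms_anti// !card_coatoms_factorial// rq; clear; lia.
have /fsetP/(_ p) : atoms x z' = (atoms x y `\` X)%fset.
  apply: fset_eqEcard.
    apply/fsubsetP => q qz'; rewrite in_fsetD (fsubsetP (atoms_mono x z'y))//.
    rewrite andbT in_fset_filter negb_and negbK; apply/orP; right.
    by move: qz'; rewrite in_atoms => /andP[/andP[_ qz'] _]; exact: coatoms_anti.
  have Xsub : (X `<=` atoms x y)%fset by apply/fsubsetP => q; rewrite in_fset_filter => /andP[].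
  rewrite cardfsDS// !card_atoms_factorial//.
    have := rank_le lf gr z'y; have := rank_le lf gr xz'.
    by move: cardX; clear; lia.
  exact: factorial_intervalS fxy _ _.
have -> : p \in (atoms x y `\` X)%fset.
  rewrite in_fsetD /X in_fset_filter in_atoms xp py rp eqxx /= negbK.
  by rewrite (fsubset_trans sub (coatoms_anti y pz)).
by rewrite in_atoms => /andP[/andP[]].
Qed.

End FactorialIntervals.

Lemma leEset (T : finType) (A B : {set T}) : (A <= B)%O = (A \subset B).
Proof. by rewrite /Order.le. Qed.

(** * Boolean isomorphisms from the sets of missing coatoms *)

Section IntervalIso.
Context {d : Order.disp_t} {P : bPOrderType d}.
Implicit Types (x y z u p c : P).
Local Open Scope order_scope.

(** The isomorphisms are naturally defined on the interval, whereas [interval_iso] asks for a map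
    from the model. The inverse comes from choice, and injectivity from antisymmetry. *)
Lemma interval_iso_of_inverse d' (S : porderType d') x y (g : P -> S) :
  {in itv x y &, forall a b, (g a <= g b) = (a <= b)} -> locally_finite P ->
  (forall s, exists2 a, x <= a <= y & g a = s) -> interval_iso x y S.
Proof.
move=> gm lf gs; have /choice[f fP] : forall s, exists a, a \in itv x y /\ g a = s.
  by move=> s; have [a aI ga] := gs s; exists a; rewrite in_fitv.
have fm : {mono f : a b / a <= b}.
  move=> a b; have [fa ga] := fP a; have [fb gb] := fP b.
  by rewrite -gm// ga gb.
exists f => //; split.
- by move=> s _; have [+ _] := fP s; rewrite in_fitv// => /in_itvE.
- by move=> a b _ _ fab; apply/le_anti; rewrite -!fm fab lexx.
move=> a /in_itvE aI; exists (g a) => //.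
have [fI gfa] := fP (g a); have aI' : a \in itv x y by rewrite in_fitv.
by apply/le_anti; rewrite -!gm// gfa lexx.
Qed.

Hypotheses (lf : locally_finite P) (gr : graded_intervals P).

Section Enumeration.
Variables (x y : P) (n : nat).
Hypotheses (fxy : factorial_interval x y) (xy : x <= y).
Hypothesis rn : (rank y - rank x = n)%N.

(** The default [\bot] is never reached, since there are exactly [n] coatoms. *)
Definition enum_coatom (i : 'I_n) : P := nth \bot (coatoms x y) i.

Lemma enum_coatomP c : reflect (exists i, c = enum_coatom i) (c \in coatoms x y).
Proof.
have sz : size (coatoms x y) = n by rewrite [LHS](card_coatoms_factorial lf gr).
apply: (iffP idP) => [cC|[i ->]]; last by rewrite mem_nth// sz.
have lti : (index c (coatoms x y) < n)%N by rewrite -sz index_mem.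
by exists (Ordinal lti); rewrite /enum_coatom nth_index.
Qed.

Lemma enum_coatom_inj : injective enum_coatom.
Proof.
have sz : size (coatoms x y) = n by rewrite [LHS](card_coatoms_factorial lf gr).
move=> i j /eqP; rewrite nth_uniq ?sz ?ltn_ord ?fset_uniq//.
by move/eqP/val_inj.
Qed.

(** The complement is taken because a larger element lies below fewer coatoms; this makes the map
    increasing. *)
Definition coatoms_missing z : {set 'I_n} := [set i | ~~ (z <= enum_coatom i)].

Lemma coatoms_missing_mono : {in itv x y &, forall a b,
  (coatoms_missing a \subset coatoms_missing b) = (a <= b)}.
Proof.
move=> a b; rewrite !in_fitv// => aI bI.
apply/idP/idP => [/fintype.subsetP sub|ab]; last first.
  apply/fintype.subsetP => i; rewrite !inE; apply: contra; exact: le_trans.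
apply: (coatoms_sub_le lf gr fxy aI bI); apply/fsubsetP => c cb.
have /andP[xb _] := bI; have cx := fsubsetP (coatoms_anti lf y xb) _ cb.
have /enum_coatomP[i cE] := cx; move: cb cx.
rewrite !in_coatoms// => /andP[/andP[bc ->] ->] _; rewrite !andbT.
rewrite cE; apply/negPn/negP => nai.
by have := sub i; rewrite !inE nai -cE bc => /(_ isT).
Qed.

Lemma coatoms_missing_surj (S : {set 'I_n}) :
  exists2 z, x <= z <= y & coatoms_missing z = S.
Proof.
pose T := [fset enum_coatom i | i in [pred i | i \notin S]]%fset.
have TP i : (enum_coatom i \in T) = (i \notin S).
  by rewrite mem_imfset//; exact: enum_coatom_inj.
have [|z zI zT] := @coatoms_surj _ _ lf gr x y T fxy xy.
  by apply/fsubsetP => _ /imfsetP[i _ ->]; apply/enum_coatomP; exists i.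
exists z => //; apply/setP => i; rewrite inE -[RHS]negbK -TP -zT in_coatoms//.
have /enum_coatomP : exists j, enum_coatom i = enum_coatom j by exists i.
by rewrite in_coatoms// => /andP[/andP[_ ->] ->]; rewrite !andbT.
Qed.

Lemma factorial_interval_iso : interval_iso x y {set 'I_n}.
Proof.
apply: (interval_iso_of_inverse _ lf coatoms_missing_surj) => a b aI bI.
by rewrite leEset; exact: coatoms_missing_mono.
Qed.

End Enumeration.

Lemma coatoms_inj x y z z' : factorial_interval x y ->
  x <= z <= y -> x <= z' <= y -> coatoms z y = coatoms z' y -> z = z'.
Proof.
move=> fxy zI z'I zz'; apply/le_anti.
by apply/andP; split; apply: (coatoms_sub_le lf gr fxy); rewrite ?zz' ?fsubset_refl.
Qed.

(** The element is the one whose coatoms are exactly [c] and [c']. Any other candidate of corank 2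
    has two coatoms, hence the same ones. *)
Lemma coatoms_pair x y c c' : factorial_interval x y ->
  c \in coatoms x y -> c' \in coatoms x y -> c != c' ->
  exists z, [/\ x <= z <= y, z <= c, z <= c', ((rank z).+2 = rank y)%N &
    forall w, x <= w -> w <= c -> w <= c' -> (rank w).+2 = rank y -> w = z].
Proof.
move=> fxy cC c'C cc'; have := cC; have := c'C.
rewrite !in_coatoms// => /andP[/andP[xc' c'y] rc'] /andP[/andP[xc cy] rc].
have sub : ([fset c; c'] `<=` coatoms x y)%fset.
  by apply/fsubsetP => w; rewrite in_fset2 => /orP[]/eqP ->.
have [z zI zE] := coatoms_surj lf gr fxy (le_trans xc cy) sub.
have /andP[xz zy] := zI; have fzy := factorial_intervalS fxy xz (lexx y).
have : #|` coatoms z y| = 2%N by rewrite zE cardfs2 cc'.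
rewrite (card_coatoms_factorial lf gr)// => rz.
have mem w : w \in [fset c; c']%fset -> z <= w.
  by rewrite -zE in_coatoms// => /andP[/andP[]].
exists z; split => //.
- by apply: mem; rewrite in_fset2 eqxx.
- by apply: mem; rewrite in_fset2 eqxx orbT.
- by move: rz; clear; lia.
move=> w xw wc wc' rw; have wy := le_trans wc cy.
have fwy := factorial_intervalS fxy xw (lexx y).
apply: (coatoms_inj fxy); rewrite ?xw//; apply/esym; rewrite zE.
apply: fset_eqEcard.
  by apply/fsubsetP => v; rewrite in_fset2 => /orP[]/eqP ->; rewrite in_coatoms// ?wc ?wc' ?cy ?c'y.
by rewrite (card_coatoms_factorial lf gr)// cardfs2 cc' -rw -addn2 addKn.
Qed.

End IntervalIso.

(** * Atoms and coatoms of Sheffer intervals *)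

Section ShefferCounting.
Context {d : Order.disp_t} {P : bPOrderType d}.
Implicit Types (x y z p c : P).
Local Open Scope order_scope.

Hypotheses (lf : locally_finite P) (gr : graded_intervals P).

Lemma nb_max_chains_cover x y : x <= y -> rank y = (rank x).+1 ->
  nb_max_chains x y = 1%N.
Proof.
move=> xy rxy; rewrite /nb_max_chains.
suff -> : max_chains x y = [set [set x; y]]%classic.
  by rewrite fset_set1 cardfs1.
have CE C : max_chains x y C -> C = [set x; y]%classic.
  move=> mC; have [CI _ _] := mC; have [Cx Cy] := max_chain_ends xy mC.
  apply/seteqP; split=> [z /CI/in_itvE/andP[xz zy]|z [->|->]//].
  have := rank_le lf gr xz; rewrite leq_eqVlt => /orP[/eqP rz|rz].
    by left; apply/esym/(rank_inj lf gr xz); rewrite rz.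
  by right; apply: (rank_inj lf gr zy); rewrite rxy.
have [C mC] := max_chains_exist lf x y.
by apply/seteqP; split=> [C' /CE|C' ->]//; rewrite -(CE _ mC).
Qed.

Variable D : nat -> nat.
Hypothesis hF : forall x y, x != \bot -> factorial_interval x y.
Hypothesis hD : forall y, y != \bot -> nb_max_chains \bot y = D (rank y).
Hypothesis hR : forall r : nat, exists y : P, rank y = r.

Let neq_bot y : (0 < rank y)%N = (y != \bot).
Proof. by rewrite lt0n (rank_eq0 lf gr). Qed.

Lemma sheffer1 : D 1 = 1%N.
Proof.
have [y ry] := hR 1; rewrite -ry -hD -?neq_bot ?ry//.
by apply: nb_max_chains_cover; rewrite ?le0x// (rank_bot lf gr).
Qed.

Lemma sheffer_gt0 n : (0 < n)%N -> (0 < D n)%N.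
Proof.
move=> n0; have [y ry] := hR n.
by rewrite -ry -hD ?(nb_max_chains_gt0 lf)// -neq_bot ry.
Qed.

Lemma card_level_sheffer y k : (0 < k <= rank y)%N ->
  (#|` level \bot y k| * (D k * (rank y - k)`!) = D (rank y))%N.
Proof.
move=> kI; have y0 : y != \bot by rewrite -neq_bot; lia.
rewrite -hD// (@nb_max_chains_level _ _ lf gr \bot y k)//; last first.
  by rewrite (rank_bot lf gr); lia.
apply/esym/sum_fset_const => z; rewrite in_level// => /andP[/andP[_ zy] /eqP rz].
have z0 : z != \bot by rewrite -neq_bot rz; lia.
by rewrite hD// rz (hF z0 (lexx z) zy (lexx y)) rz.
Qed.

(* The number of atoms of a Sheffer [n]-interval; the division is exact. *)
Definition natoms n := (D n %/ (n.-1)`!)%N.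

Lemma card_atoms_sheffer y : y != \bot -> #|` atoms \bot y| = natoms (rank y).
Proof.
rewrite -neq_bot => r0; have := @card_level_sheffer y 1 r0.
rewrite sheffer1 mul1n subn1 /natoms /atoms (rank_bot lf gr) => <-.
by rewrite mulnK// fact_gt0.
Qed.

Lemma shefferE n : (0 < n)%N -> D n = (natoms n * (n.-1)`!)%N.
Proof.
move=> n0; have [y ry] := hR n; rewrite -ry in n0 *.
rewrite -card_atoms_sheffer -?neq_bot// /atoms (rank_bot lf gr).
by rewrite -(@card_level_sheffer y 1 n0) sheffer1 mul1n subn1.
Qed.

Lemma natoms1 : natoms 1 = 1%N.
Proof. by rewrite /natoms sheffer1. Qed.

Lemma natoms_gt0 n : (0 < n)%N -> (0 < natoms n)%N.
Proof.
by move=> n0; have := sheffer_gt0 n0; rewrite shefferE// muln_gt0 => /andP[].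
Qed.

(** Both sides count the pairs of an atom and an element of rank [k] above it, the interval above an
    atom being Boolean. The proof cancels factorials in the count of chains instead. *)
Lemma card_level_natoms y k : (0 < k <= rank y)%N ->
  (#|` level \bot y k| * natoms k =
    natoms (rank y) * 'C((rank y).-1, k.-1))%N.
Proof.
move=> kI; have := card_level_sheffer kI.
have rk : (rank y - k = (rank y).-1 - k.-1)%N by lia.
have : (k.-1 <= (rank y).-1)%N by lia.
rewrite (@shefferE k) ?(@shefferE (rank y)); [|lia..].
move=> /bin_fact <-; rewrite rk -!mulnA !mulnA => /eqP.
rewrite -!(mulnA _ (k.-1)`!) eqn_pmul2r ?muln_gt0 ?fact_gt0// => /eqP.
by [].
Qed.

Lemma card_coatoms_sheffer y n : rank y = n.+2 ->
  (#|` coatoms \bot y| * natoms n.+1 = natoms n.+2 * n.+1)%N.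
Proof.
move=> ry; have y0 : \bot < y by rewrite lt0x -neq_bot ry.
rewrite (coatomsE lf gr y0) ry /=.
have := @card_level_natoms y n.+1; rewrite ry leqnSn => /(_ isT) ->.
by rewrite /= binSn.
Qed.

Lemma natoms_mono n : (0 < n)%N -> (natoms n <= natoms n.+1)%N.
Proof.
move=> n0; have [y ry] := hR n.+1.
have [|z /andP[_ zy] rz] := @level_ex _ _ lf gr \bot y n (le0x y).
  by rewrite (rank_bot lf gr) ry leqnSn.
rewrite -ry -rz -!card_atoms_sheffer -?neq_bot ?rz ?ry//.
by apply: fsubset_leq_card; exact: atoms_mono.
Qed.

Lemma coatom_over_atom y p : (1 < rank y)%N -> p \in atoms \bot y ->
  exists2 c, c \in coatoms \bot y & p <= c.
Proof.
move=> ry; rewrite in_atoms// (rank_bot lf gr) => /andP[/andP[_ py] /eqP rp].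
have [|z /andP[pz zy] rz] := @level_ex _ _ lf gr p y (rank y).-1 py.
  by rewrite rp; lia.
exists z => //; rewrite in_coatoms// zy le0x rz/=.
by apply/eqP; lia.
Qed.

Lemma in_coatoms_bot y c : (c \in coatoms \bot y) = (c <= y) && ((rank c).+1 == rank y).
Proof. by rewrite in_coatoms// le0x. Qed.

Lemma in_atoms_bot y p : (p \in atoms \bot y) = (p <= y) && (rank p == 1%N).
Proof. by rewrite in_atoms// le0x (rank_bot lf gr). Qed.

Lemma card_atoms_coatom y c n : rank y = n.+2 -> c \in coatoms \bot y ->
  #|` atoms \bot c| = natoms n.+1.
Proof.
move=> ry; rewrite in_coatoms_bot ry eqSS => /andP[_ /eqP rc].
by rewrite card_atoms_sheffer -?neq_bot rc.
Qed.

Lemma card_coatoms_atom y p : y != \bot -> p \in atoms \bot y ->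
  #|` coatoms p y| = (rank y).-1.
Proof.
move=> y0; rewrite in_atoms_bot => /andP[py /eqP rp].
by rewrite (card_coatoms_factorial lf gr)// ?rp ?subn1//; apply: hF; rewrite -neq_bot rp.
Qed.

(* [[p, y]] is Boolean for each atom [p], so the common atoms of [c] and [c']
   are partitioned by the elements of corank 2 below both of them. *)
Lemma dvd_common_atoms y c c' n : rank y = n.+3 ->
  c \in coatoms \bot y -> c' \in coatoms \bot y -> c != c' ->
  (natoms n.+1 %| #|` (atoms \bot c `&` atoms \bot c')%fset|)%N.
Proof.
move=> ry cC c'C cc'; have := cC; have := c'C; rewrite !in_coatoms_bot ry !eqSS.
move=> /andP[c'y /eqP rc'] /andP[cy /eqP rc].
pose Z := [fset z in level \bot y n.+1 | (z <= c) && (z <= c')]%fset.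
have ZP z : (z \in Z) = [&& z <= y, rank z == n.+1, z <= c & z <= c'].
  by rewrite in_fset_filter in_level// le0x /= -andbA.
suff <- : (\sum_(z <- Z) #|` [fset p in (atoms \bot c `&` atoms \bot c')%fset
    | (p <= z)%O]%fset| = #|` (atoms \bot c `&` atoms \bot c')%fset|)%N.
  rewrite (@sum_fset_const _ _ _ (natoms n.+1)) ?dvdn_mull// => z.
  rewrite ZP => /and4P[zy /eqP rz zc zc']; rewrite -rz.
  rewrite -card_atoms_sheffer -?neq_bot ?rz//; congr #|` _|%fset.
  apply/fsetP => p; rewrite in_fset_filter in_fsetI !in_atoms_bot.
  have [pz|] := boolP (p <= z); last by rewrite andbF.
  by rewrite (le_trans pz zc) (le_trans pz zc') /= andbT andbb.
rewrite (double_count _ _ (fun z p => (p <= z)%O)).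
rewrite (@sum_fset_const _ _ _ 1%N) ?muln1// => p.
rewrite in_fsetI !in_atoms_bot => /andP[/andP[pc /eqP rp] /andP[pc' _]].
have fpy : factorial_interval p y by apply: hF; rewrite -neq_bot rp.
have [|||z [/andP[pz zy] zc zc' rz uz]] := @coatoms_pair _ _ lf gr p y c c' fpy.
- by rewrite in_coatoms// pc cy rc ry/=.
- by rewrite in_coatoms// pc' c'y rc' ry/=.
- exact: cc'.
have zZ : z \in Z.
  by rewrite ZP zy zc zc' /= andbT; move: rz; rewrite ry => -[->].
rewrite (big_fsetD1 z)//= pz big1_seq ?addn0// => w /=.
rewrite in_fsetD1 ZP => /andP[wz /and4P[wy /eqP rw wc wc']].
apply/eqP; rewrite eqb0; apply: contra wz => pw; apply/eqP/uz => //.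
by rewrite rw.
Qed.

(** The number is a multiple of [natoms n.+1] and at most [natoms n.+2], so the multiplier is 0 or
    1. *)
Lemma card_common_atoms y c c' n : rank y = n.+3 ->
  (natoms n.+2 < 2 * natoms n.+1)%N ->
  c \in coatoms \bot y -> c' \in coatoms \bot y -> c != c' ->
  #|` (atoms \bot c `&` atoms \bot c')%fset| = 0%N \/
  #|` (atoms \bot c `&` atoms \bot c')%fset| = natoms n.+1.
Proof.
move=> ry lt2 cC c'C cc'; have /dvdnP[k kE] := dvd_common_atoms ry cC c'C cc'.
have : (k * natoms n.+1 < 2 * natoms n.+1)%N.
  rewrite -kE (leq_ltn_trans _ lt2)// -(card_atoms_coatom ry cC).
  by apply: fsubset_leq_card; exact: fsubsetIl.
rewrite ltn_pmul2r ?natoms_gt0// kE.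
by case: k {kE} => [|[|k]]// _; [left|right; rewrite mul1n].
Qed.

Lemma card_atoms_union y c c' n : rank y = n.+2 ->
  c \in coatoms \bot y -> c' \in coatoms \bot y ->
  (2 * natoms n.+1 <=
   natoms n.+2 + #|` (atoms \bot c `&` atoms \bot c')%fset|)%N.
Proof.
move=> ry cC c'C; rewrite mul2n -addnn -{1}(card_atoms_coatom ry cC).
rewrite -(card_atoms_coatom ry c'C) -cardfsUI leq_add2r.
rewrite -ry -card_atoms_sheffer -?neq_bot ?ry//.
apply: fsubset_leq_card; move: cC c'C; rewrite !in_coatoms_bot.
move=> /andP[cy _] /andP[c'y _]; rewrite fsubUset.
by rewrite !atoms_mono.
Qed.

(** Two coatoms of an [n.+3]-interval have [natoms n.+2] atoms each and at most [natoms n.+1] in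
    common, and their union fits into the atoms of the interval. *)
Lemma natoms_lower n : (natoms n.+2 < 2 * natoms n.+1)%N ->
  (2 * natoms n.+2 <= natoms n.+3 + natoms n.+1)%N.
Proof.
move=> lt2; have [y ry] := hR n.+3.
have cardC := card_coatoms_sheffer ry.
have mono := @natoms_mono n.+2 isT.
have p2 := @natoms_gt0 n.+2 isT.
have [c cC] : exists c, c \in coatoms \bot y.
  by apply/fset0Pn; rewrite -cardfs_gt0; nia.
have [c'] : exists c', c' \in (coatoms \bot y `\ c)%fset.
  apply/fset0Pn; rewrite -cardfs_gt0.
  by have := cardfsD1 c (coatoms \bot y); rewrite cC; nia.
rewrite in_fsetD1 eq_sym => /andP[cc' c'C].
apply: leq_trans (card_atoms_union ry cC c'C) _; rewrite leq_add2l.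
by have [->|->] := card_common_atoms ry lt2 cC c'C cc'.
Qed.

(** Among three atoms, two coatoms with two atoms each must share one; sharing 0 or 2 is all that is
    possible, so all coatoms have the same two atoms. The third atom would then lie below no
    coatom. *)
Lemma natoms_neq3 n : natoms n.+1 = 2%N -> natoms n.+2 = 2%N -> natoms n.+3 <> 3%N.
Proof.
move=> a1 a2 a3; have [y ry] := hR n.+3.
have [c cC] : exists c, c \in coatoms \bot y.
  apply/fset0Pn; rewrite -cardfs_gt0.
  by have := card_coatoms_sheffer ry; rewrite a2 a3; lia.
suff : (atoms \bot y `<=` atoms \bot c)%fset.
  move/fsubset_leq_card; rewrite (card_atoms_coatom ry cC) a2.
  by rewrite card_atoms_sheffer -?neq_bot ry// a3.
apply/fsubsetP => p py.
have [|c' c'C pc'] := @coatom_over_atom y p _ py; first by rewrite ry.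
have pc'A : p \in atoms \bot c'.
  by move: py; rewrite !in_atoms_bot pc' => /andP[].
have [->//|c'c] := eqVneq c c'.
have lt2 : (natoms n.+2 < 2 * natoms n.+1)%N by rewrite a1 a2.
have := card_common_atoms ry lt2 cC c'C c'c; have := card_atoms_union ry cC c'C.
rewrite a1 a2 a3 => le4 [c0|c2]; first by rewrite c0 in le4.
have : (atoms \bot c `&` atoms \bot c' = atoms \bot c')%fset.
  by apply: fset_eqEcard; rewrite ?fsubsetIr// (card_atoms_coatom ry c'C) c2 a2.
by move/fsetP/(_ p); rewrite in_fsetI pc'A andbT.
Qed.

(* Both sides count the pairs of an atom of [c] and another coatom above it;
   an atom of [y] lies below [n.+1] coatoms. *)
Lemma sum_common_atoms y c n : rank y = n.+2 -> c \in coatoms \bot y ->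
  (\sum_(c' <- (coatoms \bot y `\ c)%fset)
     #|` (atoms \bot c `&` atoms \bot c')%fset| = natoms n.+1 * n)%N.
Proof.
move=> ry cC; have y0 : y != \bot by rewrite -neq_bot ry.
under eq_bigr => c' _.
  have -> : (atoms \bot c `&` atoms \bot c')%fset =
      [fset p in atoms \bot c | (p <= c')%O]%fset.
    apply/fsetP => p; rewrite in_fset_filter in_fsetI !in_atoms_bot.
    by case: (rank p == 1); rewrite ?andbF ?andbT.
  over.
rewrite (double_count _ _ (fun c' p => (p <= c')%O)) -(card_atoms_coatom ry cC).
apply: sum_fset_const => p; rewrite in_atoms_bot => /andP[pc rp].
have cy : c <= y by move: cC; rewrite in_coatoms_bot => /andP[].
have pA : p \in atoms \bot y by rewrite in_atoms_bot rp (le_trans pc).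
rewrite -card_fset_filter.
have -> : [fset c' in coatoms \bot y `\ c | (p <= c')%O]%fset =
    (coatoms p y `\ c)%fset.
  apply/fsetP => c'; rewrite in_fset_filter !in_fsetD1 in_coatoms_bot in_coatoms//.
  by case: (p <= c'); rewrite ?andbF ?andbT.
have := cardfsD1 c (coatoms p y); rewrite (card_coatoms_atom y0 pA) ry.
have -> : c \in coatoms p y.
  by move: cC; rewrite in_coatoms_bot in_coatoms// pc => /andP[-> ->].
by rewrite /= add1n => -[].
Qed.

(** The bound forces any two coatoms of an [n.+2]-interval to share an atom, hence exactly [n]
    atoms. The incidence count then gives [n.+1] coatoms besides a given one, and there are as many
    coatoms as atoms. *)
Lemma natoms_simplex n : (1 < n)%N -> natoms n = n -> natoms n.+1 = n.+1 ->
  (natoms n.+2 < 2 * n.+1)%N -> natoms n.+2 = n.+2.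
Proof.
case: n => // n n0 a1 a2 lt2; have [y ry] := hR n.+3.
have cardC := card_coatoms_sheffer ry.
have a3p := @natoms_gt0 n.+3 isT.
have {}cardC : #|` coatoms \bot y| = natoms n.+3.
  by move: cardC; rewrite a2 => /eqP; rewrite eqn_pmul2r// => /eqP.
have [c cC] : exists c, c \in coatoms \bot y.
  by apply/fset0Pn; rewrite -cardfs_gt0 cardC.
have lt2' : (natoms n.+2 < 2 * natoms n.+1)%N by rewrite a1 a2; lia.
have := sum_common_atoms ry cC; rewrite (@sum_fset_const _ _ _ n.+1).
  rewrite a2 => /eqP; rewrite eqn_pmul2r//.
  have := cardfsD1 c (coatoms \bot y); rewrite cC cardC.
  by move=> -> /eqP <-.
move=> c'; rewrite in_fsetD1 eq_sym => /andP[cc' c'C].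
have := card_common_atoms ry lt2' cC c'C cc'.
have := card_atoms_union ry cC c'C; rewrite a1 a2 => le2 [] c0 //.
by rewrite c0 in le2; lia.
Qed.

End ShefferCounting.

(** * The number of atoms *)

Section SelfInverse.
Local Open Scope ring_scope.
Implicit Types (v w : nat -> rat) (m n N : nat).

Definition self_inverse v :=
  forall N, v N = \sum_(j < N.+1) (-1) ^+ j * 'C(N, j)%:R * v j.

Lemma self_inverseB v w : self_inverse v -> self_inverse w ->
  self_inverse (fun j => v j - w j).
Proof.
move=> sv sw N; rewrite sv sw -sumrB; apply: eq_bigr => j _.
by rewrite mulrBr.
Qed.

(** This is the binomial expansion of [(1 - 1/2) ^ N]. *)
Lemma self_inverse_cube : self_inverse (fun j => 2^-1 ^+ j).
Proof.
move=> N; have -> : 2^-1 = 1 - 2^-1 :> rat by lra.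
rewrite exprBn; apply: eq_bigr => j _.
rewrite expr1n mulr1 [in RHS](_ : 1 - 2^-1 = 2^-1); last by lra.
by rewrite -mulrA (mulrC ('C(_, _)%:R)) mulrA mulr_natr.
Qed.

Lemma alternating_bin N : \sum_(i < N.+2) (-1) ^+ i * 'C(N.+1, i)%:R = 0 :> rat.
Proof.
transitivity ((1 - 1 : rat) ^+ N.+1); last by rewrite subrr expr0n.
by rewrite exprBn; apply: eq_bigr => i _; rewrite !expr1n !mulr1 mulr_natr.
Qed.

(** The identity ['C(N, j) / j.+1 = 'C(N.+1, j.+1) / N.+1] reduces this to the alternating sum of
    row [N.+1], without its first term. *)
Lemma self_inverse_simplex : self_inverse (fun j => j.+1%:R^-1).
Proof.
move=> N; have := alternating_bin N; rewrite big_ord_recl /= expr0 mul1r bin0.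
move=> /eqP; rewrite addrC addr_eq0 => /eqP alt.
apply: (@mulfI _ (- N.+1%:R)); first by rewrite oppr_eq0 pnatr_eq0.
rewrite mulNr mulfV ?pnatr_eq0// -[LHS]alt mulr_sumr; apply: eq_bigr => j _.
rewrite exprS /bump /= add1n.
have jN : j.+1%:R != 0 :> rat by rewrite pnatr_eq0.
have := mul_bin_diag N.+1 j; rewrite /= => /(congr1 (fun n => n%:R : rat)).
rewrite !natrM => E; apply: (@mulIf _ j.+1%:R) => //.
by rewrite -!mulrA mulVf// mulr1 !mulNr mul1r (mulrCA N.+1%:R) E (mulrC 'C(_, _)%:R).
Qed.

(** Half of a vanishing alternating row sum, corrected at index 0, where the value is 1 instead of
    1/2. *)
Lemma self_inverse_suspension :
  self_inverse (fun j => if j is 0%N then 1 else 2^-1).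
Proof.
case=> [|N]; first by rewrite big_ord1 expr0 bin0 !mul1r.
have := alternating_bin N.
rewrite big_ord_recl expr0 bin0 !mul1r => alt.
rewrite big_ord_recl expr0 bin0 !mul1r.
rewrite [X in 1 + X](_ : _ = (\sum_(i < N.+1)
    (-1) ^+ lift ord0 i * 'C(N.+1, lift ord0 i)%:R) * 2^-1); first by lra.
by rewrite mulr_suml.
Qed.

Section Vanishing.
Variables (v : nat -> rat) (m : nat).
Hypothesis sv : self_inverse v.
Hypothesis v0 : forall j, (j < m.*2)%N -> v j = 0.

(** To be applied to the difference of [v] and a model sequence. As [m.*2] is even, the signs of the
    remaining terms start afresh. *)
Lemma self_inverse_tail k : v (m.*2 + k)%N =
  \sum_(i < k.+1) (-1) ^+ i * 'C(m.*2 + k, k - i)%:R * v (m.*2 + i)%N.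
Proof.
rewrite {1}sv -addnS big_split_ord /= big1 ?add0r => [|j _]; last first.
  by rewrite v0 ?mulr0.
apply: eq_bigr => i _; rewrite exprD -signr_odd odd_double expr0 mul1r.
have ik : (m.*2 + i <= m.*2 + k)%N by rewrite leq_add2l -ltnS.
by rewrite -(bin_sub ik) subnDl.
Qed.

Lemma self_inverse_tail1 : 2 * v m.*2.+1 = m.*2.+1%:R * v m.*2.
Proof.
have := self_inverse_tail 1.
by rewrite !big_ord_recl big_ord0 /= addn0 addn1 subn0 bin1 bin0 expr1; lra.
Qed.

(** The relation at [m.*2.+2] only repeats [self_inverse_tail1], so the value there stays free and
    appears on the right. *)
Lemma self_inverse_tail3 : 2 * v m.*2.+3 =
  'C(m.*2.+3, 3)%:R * v m.*2 - 'C(m.*2.+3, 2)%:R * v m.*2.+1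
  + m.*2.+3%:R * v m.*2.+2.
Proof.
have := self_inverse_tail 3; rewrite !big_ord_recl big_ord0 /= /bump /=.
by rewrite !addn0 !add1n !addnS addn0 subn0 bin1 bin0 !exprS expr0; lra.
Qed.

End Vanishing.

(** Odd indices follow from [self_inverse_tail1]. Index 2 is a separate hypothesis because the three
    sequences part there, and [step] starts at index 4. *)
Lemma self_inverse_ind v w : self_inverse v -> self_inverse w ->
  v 0%N = w 0%N -> v 2 = w 2 ->
  (forall m, (1 < m)%N -> (forall j, (j < m.*2)%N -> v j = w j) ->
    v m.*2 = w m.*2) ->
  forall j, v j = w j.
Proof.
move=> sv sw e0 e2 step.
suff H m : forall j, (j < m.*2)%N -> v j = w j.
  by move=> j; apply: (H j.+1); lia.
elim: m => // m IH.
have em : v m.*2 = w m.*2.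
  by case: m IH => [|[|m]] IH; [exact: e0|exact: e2|exact: step].
have odd_case := self_inverse_tail1 (self_inverseB sv sw) (m := m).
move=> j; rewrite doubleS !ltnS leq_eqVlt ltnS leq_eqVlt => /or3P[/eqP->|/eqP->|]//.
  have : 2 * (v m.*2.+1 - w m.*2.+1) = m.*2.+1%:R * (v m.*2 - w m.*2).
    by apply: odd_case => i im; rewrite IH ?subrr.
  by rewrite em subrr mulr0; lra.
exact: IH.
Qed.

End SelfInverse.

(** * Estimates for the numbers of atoms at odd ranks *)

Section Numerics.
Local Open Scope ring_scope.
Implicit Types (v : nat -> rat) (m n C : nat).

Lemma bin2_rat n : 'C(n.+2, 2)%:R = n.+2%:R * n.+1%:R / 2 :> rat.
Proof.
apply: (@mulIf _ 2) => //; rewrite divfK// -!natrM.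
by have := bin_ffact n.+2 2; rewrite !ffactSS ffactn0 muln1 => ->.
Qed.

Lemma bin3_rat n : 'C(n.+3, 3)%:R = n.+3%:R * n.+2%:R * n.+1%:R / 6 :> rat.
Proof.
apply: (@mulIf _ 6) => //; rewrite divfK// -!natrM.
by have := bin_ffact n.+3 3; rewrite !ffactSS ffactn0 muln1 mulnA => ->.
Qed.

(** In the application [C] is the number of coatoms of a [(2 m + 1)]-interval, which is [4 m] for
    the cube. Computing [v m.*2.+1] from the deviation at [m.*2] gives the equation, and its
    positivity gives [C <= 4 m + 1]. *)
Lemma cube_coatoms v m C : self_inverse v -> (0 < m)%N ->
  (forall j, (j < m.*2)%N -> v j = 2^-1 ^+ j) ->
  (forall j, 0 < v j) -> (forall j, v j.+1 <= v j) -> (0 < C)%N ->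
  C%:R * v m.*2 = (4 * m)%N%:R * 2^-1 ^+ m.*2 ->
  (C <= 4 * m)%N /\
  v m.*2.+1 * C%:R = 2^-1 ^+ m.*2 * m%:R * ((4 * m + 2)%N%:R - C%:R).
Proof.
move=> sv m0 vj vpos vdec C0 CE.
have sd := self_inverseB sv self_inverse_cube.
have d0 j : (j < m.*2)%N -> v j - 2^-1 ^+ j = 0 by move=> /vj ->; rewrite subrr.
have t1 := self_inverse_tail1 sd d0; have t3 := self_inverse_tail3 sd d0.
rewrite bin2_rat bin3_rat !exprS in t1 t3.
have n1 : m.*2.+1%:R = 2 * m%:R + 1 :> rat by rewrite -addn1 natrD -mul2n natrM.
have n2 : m.*2.+2%:R = 2 * m%:R + 2 :> rat by rewrite -addn2 natrD -mul2n natrM.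
have n3 : m.*2.+3%:R = 2 * m%:R + 3 :> rat by rewrite -addn3 natrD -mul2n natrM.
rewrite n1 n2 n3 in t1 t3; move: CE t1 t3.
have := vpos m.*2.+1; have := vpos m.*2.+2; have := vdec m.*2.+2.
have q0 : 0 < 2^-1 ^+ m.*2 :> rat by rewrite exprn_gt0.
rewrite (natrD _ (4 * m)%N) !natrM.
move: (v m.*2) (v m.*2.+1) (v m.*2.+2) (v m.*2.+3) (2^-1 ^+ m.*2) q0.
move=> x y z t q q0 tz z0 y0 CE t1 t3.
have M1 : 1 <= m%:R :> rat by rewrite ler1n.
have C0' : 0 < C%:R :> rat by rewrite ltr0n.
have yE : y * C%:R = q * m%:R * (4 * m%:R + 2 - C%:R).
  have -> : y = (q + (2 * m%:R + 1) * (x - q)) / 2 by lra.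
  have -> : (q + (2 * m%:R + 1) * (x - q)) / 2 * C%:R =
    (q * C%:R + (2 * m%:R + 1) * (C%:R * x - q * C%:R)) / 2 by ring.
  by rewrite CE; field.
split=> //.
have ltC : (C < 4 * m + 2)%N.
  rewrite -(ltr_nat rat) (natrD _ (4 * m)%N) natrM -subr_gt0.
  have : 0 < q * m%:R * (4 * m%:R + 2 - C%:R) by rewrite -yE mulr_gt0.
  by rewrite pmulr_rgt0// mulr_gt0// (lt_le_trans ltr01).
(* The value [4 m + 1] passes the test at [m.*2.+1]. With the deviation [w] now negative,
   [self_inverse_tail3] would make [v] increase from [m.*2.+2] to [m.*2.+3]. *)
have [//|ltC'] := leqP C (4 * m); exfalso.
have CE' : C = (4 * m + 1)%N by lia.
rewrite CE' (natrD _ (4 * m)%N) natrM in CE.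
pose w := x - q.
have qE : q = - (4 * m%:R + 1) * w by rewrite /w; lra.
have xE : x = q + w by rewrite /w; lra.
have w0 : w < 0.
  have : 0 < (4 * m%:R + 1) * (- w) by rewrite mulrN -mulNr -qE.
  by rewrite pmulr_rgt0 ?oppr_gt0// ; lra.
have yE' : y = q / 2 + (2 * m%:R + 1) / 2 * w by rewrite /w; lra.
have : 2 * t - 2 * z = (2 * m%:R + 1) * z +
    (2 * m%:R + 2) * (m%:R * (m%:R - 1)) / 3 * - w.
  have -> : 2 * t = 2 * (t - 2^-1 * (2^-1 * (2^-1 * q))) + q / 4 by lra.
  by rewrite t3 yE' xE qE; field.
have : 0 < (2 * m%:R + 1) * z by rewrite mulr_gt0//; lra.
have : 0 <= (2 * m%:R + 2) * (m%:R * (m%:R - 1)) / 3 * - w.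
  by rewrite mulr_ge0 ?divr_ge0 ?mulr_ge0//; lra.
by lra.
Qed.

Section NumberOfAtoms.
(* [a n] is the number of atoms of a Sheffer [n]-interval and [v] the sequence
   of the inverses of these numbers, shifted by one. *)
Variable a : nat -> nat.
Let v j := (a j.+1)%:R^-1 : rat.

Hypothesis sv : self_inverse v.
Hypothesis a1 : a 1 = 1%N.
Hypothesis a_gt0 : forall n, (0 < n)%N -> (0 < a n)%N.
Hypothesis a_mono : forall n, (0 < n)%N -> (a n <= a n.+1)%N.
Hypothesis a_coatoms : forall n, exists C, (C * a n.+1 = a n.+2 * n.+1)%N.
Hypothesis a_lower : forall n, (a n.+2 < 2 * a n.+1)%N ->
  (2 * a n.+2 <= a n.+3 + a n.+1)%N.
Hypothesis a_neq3 : forall n, a n.+1 = 2%N -> a n.+2 = 2%N -> a n.+3 <> 3%N.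
Hypothesis a_simplex : forall n, (1 < n)%N -> a n = n -> a n.+1 = n.+1 ->
  (a n.+2 < 2 * n.+1)%N -> a n.+2 = n.+2.

Let a_neq0 n : (a n.+1)%:R != 0 :> rat.
Proof. by rewrite pnatr_eq0 -lt0n a_gt0. Qed.

Let v_gt0 j : 0 < v j.
Proof. by rewrite invr_gt0 ltr0n a_gt0. Qed.

Let v_dec j : v j.+1 <= v j.
Proof. by rewrite lef_pV2 ?posrE ?ltr0n ?a_gt0// ler_nat a_mono. Qed.

Let v0 : v 0 = 1. Proof. by rewrite /v a1 invr1. Qed.

Let v1 : v 1 = 2^-1.
Proof.
have := sv 1; rewrite !big_ord_recl big_ord0 /= bin0 binn v0 expr0 expr1.
by lra.
Qed.

Let aE j (n : nat) : v j = n%:R^-1 -> a j.+1 = n.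
Proof. by move/invr_inj/eqP; rewrite eqr_nat => /eqP. Qed.

Let a2 : a 2 = 2%N.
Proof. exact/aE/v1. Qed.

(** Here [m.+1] takes the place of [m] in [cube_coatoms], and denominators are cleared. The
    subtraction is exact since [C <= 4 * m.+1]. *)
Let coatoms_cube m C : (C * a m.*2.+2 = a m.*2.+3 * m.*2.+2)%N ->
  (forall j, (j < m.+1.*2)%N -> v j = 2^-1 ^+ j) ->
  [/\ (C <= 4 * m.+1)%N, (C * 2 ^ m.+1.*2 = 4 * m.+1 * a m.+1.*2.+1)%N,
      (a m.+1.*2.+2 * (4 * m.+1 + 2 - C) = 4 * a m.+1.*2.+1)%N &
      (2 * a m.+1.*2 = 2 ^ m.+1.*2)%N].
Proof.
move=> CE vj.
have aC : (2 * a m.+1.*2 = 2 ^ m.+1.*2)%N.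
  rewrite [m.+1.*2 in RHS](_ : _ = m.*2.+1.+1) // [RHS]expnS; congr (2 * _)%N.
  by apply: aE; rewrite vj ?doubleS// natrX exprVn.
have CE' : (C * 2 ^ m.+1.*2 = 4 * m.+1 * a m.+1.*2.+1)%N.
  have CE2 : (C * a m.+1.*2 = a m.+1.*2.+1 * (2 * m.+1))%N by rewrite mul2n.
  by rewrite -aC mulnCA CE2; lia.
have C0 : (0 < C)%N.
  case: (posnP C) CE' => // ->; rewrite mul0n => /esym/eqP.
  by rewrite muln_eq0 /= => /eqP E; have := @a_gt0 m.+1.*2.+1 isT; rewrite E.
have qX : 2^-1 ^+ m.+1.*2 = (2 ^ m.+1.*2)%N%:R^-1 :> rat.
  by rewrite natrX exprVn.
have X0 : (2 ^ m.+1.*2)%N%:R != 0 :> rat by rewrite pnatr_eq0 expn_eq0.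
have [] := cube_coatoms sv (ltn0Sn m) vj v_gt0 v_dec C0.
  by rewrite qX; apply/eqP; rewrite eqr_div// -!natrM CE'.
rewrite qX /v => leC yE; split=> //.
have CX : C%:R * (2 ^ m.+1.*2)%N%:R =
    m.+1%:R * ((4 * m.+1 + 2)%N%:R - C%:R) * (a m.+1.*2.+2)%:R :> rat.
  rewrite -[C%:R in LHS](mulVKf (a_neq0 m.+1.*2.+1)) yE; field.
  exact: X0.
apply/eqP; rewrite -(eqr_nat rat); apply/eqP; rewrite !natrM natrB; last by lia.
apply: (@mulfI _ m.+1%:R); first by rewrite pnatr_eq0.
rewrite [LHS]mulrCA [LHS]mulrC -CX -natrM CE' !natrM; ring.
Qed.

(** The cube estimate needs only [v 0] and [v 1] here, which are already known. A 3-interval has as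
    many coatoms as atoms, so the bound 4 on [C] is a bound on [a 3]. *)
Lemma natoms3 : (1 < a 3 <= 4)%N.
Proof.
have [C CE] := a_coatoms 1.
have [|leC _ _ _] := coatoms_cube (m := 0) CE.
  by case=> [|[|]]//; rewrite ?v0 ?v1 ?expr0 ?expr1.
have : (a 2 <= a 3)%N by exact: a_mono.
by move: CE; rewrite a2; lia.
Qed.

Let v2E (n : nat) : a 3 = n -> v 2 = n%:R^-1.
Proof. by rewrite /v => ->. Qed.

Lemma natoms_cube : a 3 = 4%N -> forall n, (0 < n)%N -> a n = (2 ^ n.-1)%N.
Proof.
move=> /v2E a3; suff H j : v j = 2^-1 ^+ j.
  by case=> // n _; apply: aE; rewrite H natrX exprVn.
apply: (self_inverse_ind sv self_inverse_cube); rewrite ?v0 ?a3//.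
case=> // m m1 vj; have [C CE] := a_coatoms m.*2.+1.
have [leC CX A'E aX] := coatoms_cube CE vj.
have mono := @a_mono m.+1.*2.+1 isT; have A0 := @a_gt0 m.+1.*2.+1 isT.
have low := @a_lower m.*2.+1; rewrite doubleS in CX A'E aX mono A0 low *.
suff C4 : C = (4 * m.+1)%N.
  by move/eqP: CX; rewrite C4 eqn_pmul2l// /v => /eqP <-; rewrite natrX exprVn.
move: leC CX A'E aX mono A0 low.
move: (a m.*2.+2) (a m.*2.+3) (a m.*2.+4) (2 ^ m.*2.+2)%N => A0 A A' X.
move=> leC CX A'E aX mono Apos low.
(* Monotonicity [A <= A'] leaves three values of [C]. For the two smaller ones [CX] gives
   [A < X = 2 * A0], so [low] applies, but its conclusion is false when [m.+1 > 1]. At [m.+1 = 1]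
   they would be 3 and 2, the values of the other alternatives. *)
have geC : (4 * m.+1 - 2 <= C)%N by nia.
have /or3P[/eqP|/eqP cE|/eqP cE] : [|| C == 4 * m.+1, C == 4 * m.+1 - 1 |
  C == 4 * m.+1 - 2]%N by lia.
- by [].
- rewrite cE in CX A'E; have {}A'E : (3 * A' = 4 * A)%N by rewrite -A'E; nia.
  by have := low; nia.
- rewrite cE in CX A'E; have {}A'E : (A' = A)%N by nia.
  by have := low; nia.
Qed.

(** The estimate only has to provide the upper bound required by [a_simplex]; if that bound failed,
    the next term of [v] could not be positive. *)
Lemma natoms_simplex_all : a 3 = 3%N -> forall n, (0 < n)%N -> a n = n.
Proof.
move=> /v2E a3; suff H j : v j = j.+1%:R^-1 by case=> // n _; exact: aE.
apply: (self_inverse_ind sv self_inverse_simplex); rewrite ?v0 ?a3 ?invr1//.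
case=> // m m1 vj; rewrite doubleS.
have b1 : a m.*2.+1 = m.*2.+1 by apply/aE/vj; rewrite doubleS; lia.
have b2 : a m.*2.+2 = m.*2.+2 by apply/aE/vj; rewrite doubleS; lia.
suff E : a m.*2.+3 = m.*2.+3 by rewrite /v E.
apply: a_simplex => //; first by lia.
have sd := self_inverseB sv self_inverse_simplex.
have d0 i : (i < m.+1.*2)%N -> v i - i.+1%:R^-1 = 0.
  by move=> /vj ->; rewrite subrr.
have := self_inverse_tail1 sd d0; rewrite doubleS.
have := v_gt0 m.*2.+3; move: (v m.*2.+3) => y y0.
rewrite ltnNge; move=> t1; apply/negP => leA; move: t1.
have -> : m.*2.+3%:R = 2 * m%:R + 3 :> rat by rewrite -addn3 natrD -mul2n natrM.
have -> : m.*2.+4%:R = 2 * (m%:R + 2) :> rat.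
  by rewrite -addn4 natrD -mul2n natrM; ring.
have M1 : 1 <= m%:R :> rat by rewrite ler1n.
have vA : v m.*2.+2 * (4 * m%:R + 4) <= 1.
  have -> : 4 * m%:R + 4 = (2 * m.*2.+2)%N%:R :> rat.
    by rewrite natrM -(addn2 m.*2) natrD -mul2n natrM; ring.
  rewrite -[leRHS](mulVf (a_neq0 m.*2.+2)) ler_pM2l ?v_gt0//.
  by rewrite ler_nat.
move: (v m.*2.+2) (v_gt0 m.*2.+2) vA => u u0 vA.
rewrite invfM [X in _ = X -> _]mulrBr mulfV => [t1|]; last by lra.
have sE : (m%:R + 2)^-1 * (m%:R + 2) = 1 :> rat by rewrite mulVf//; lra.
have t2 : 0 < (1 + (2 * m%:R + 3) * (m%:R + 2) * u - (m%:R + 2)).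
  rewrite -{1}sE -[X in _ - X]mul1r (mulrAC _ _ u) -mulrDl -mulrBl.
  by rewrite mulr_gt0; lra.
(* The polynomial is [(4 m + 4) (m + 1) - (2 m + 3) (m + 2)], the gap between the coefficients of
   [u] in [t4] and [t2]; it is nonnegative because [m >= 1]. *)
have t3 : 0 <= (2 * m%:R ^+ 2 + m%:R - 2) * u by rewrite mulr_ge0//; nra.
have t4 : u * (4 * m%:R + 4) * (m%:R + 1) <= 1 * (m%:R + 1).
  by rewrite ler_pM2r//; lra.
by nra.
Qed.

(** A value of at least 4 would make the next term of [v] negative, 3 is excluded by [a_neq3], and
    monotonicity excludes values below 2. *)
Lemma natoms_suspension : a 3 = 2%N -> forall n, (1 < n)%N -> a n = 2%N.
Proof.
move=> /v2E a3; suff H j : v j = if j is 0%N then 1 else 2^-1.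
  by case=> [|[|n]]// _; apply: aE; rewrite H.
apply: (self_inverse_ind sv self_inverse_suspension); rewrite ?v0 ?a3//.
case=> // m m1 vj; rewrite doubleS.
have b1 : a m.*2.+1 = 2%N.
  by apply: aE; rewrite vj; [case: (m) m1|rewrite doubleS; lia].
have b2 : a m.*2.+2 = 2%N by apply: aE; rewrite vj// doubleS.
suff E : a m.*2.+3 = 2%N by rewrite /v E.
have sd := self_inverseB sv self_inverse_suspension.
have d0 i : (i < m.+1.*2)%N -> v i - (if i is 0%N then 1 else 2^-1) = 0.
  by move=> /vj ->; rewrite subrr.
have t1 := self_inverse_tail1 sd d0; rewrite doubleS in t1.
have y0 := v_gt0 m.*2.+3.
have neq3 := a_neq3 b1 b2; have mono := @a_mono m.*2.+2 isT.
have lt4 : (a m.*2.+3 < 4)%N; last by lia.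
rewrite ltnNge; apply/negP => leA; move: t1.
have -> : m.*2.+3%:R = 2 * m%:R + 3 :> rat by rewrite -addn3 natrD -mul2n natrM.
have M1 : 1 <= m%:R :> rat by rewrite ler1n.
have vA : v m.*2.+2 * 4 <= 1.
  rewrite -[leRHS](mulVf (a_neq0 m.*2.+2)) ler_pM2l ?v_gt0//.
  by rewrite ler_nat.
have : (2 * m%:R + 3) * (v m.*2.+2 * 4) <= (2 * m%:R + 3) * 1.
  by rewrite ler_pM2l//; lra.
by lra.
Qed.

End NumberOfAtoms.
End Numerics.

(** * The Euler relation between the sizes of the levels *)

Section EulerRelation.
Context {d : Order.disp_t} {P : bPOrderType d}.
Implicit Types (x y z p c : P).
Local Open Scope order_scope.
Local Open Scope ring_scope.

Hypotheses (lf : locally_finite P) (gr : graded_intervals P).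
Hypothesis eul : eulerian P.

(** This is the recursion of the Möbius function, all of whose values are signs here. *)
Lemma sum_sign_rank y : (\bot < y)%O ->
  \sum_(z <- itv \bot y) (-1) ^+ rank z = 0 :> int.
Proof.
move=> y0; pose I := fset_set `[\bot%O, y[%classic.
have inI z : (z \in I) = (z < y)%O.
  rewrite in_fset_set; last first.
    by apply: sub_finite_set (lf \bot y) => t /=; rewrite !in_itv /= => /andP[-> /ltW].
  by apply/idP/idP; rewrite inE /= in_itv /= le0x.
have -> : itv \bot y = (y |` I)%fset.
  by apply/fsetP => z; rewrite in_fset1U in_fitv// le0x inI le_eqVlt.
rewrite big_fsetU1/= ?inI ?ltxx//.
have mu z : mobius \bot z = (-1) ^+ rank z.
  by rewrite eul ?le0x// (rank_bot lf gr) subn0.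
rewrite -mu (mobiusE _ _ lf) (lt_eqF y0).
by rewrite (eq_bigr _ (fun z _ => mu z)) addNr.
Qed.

Lemma euler_relation y : (\bot < y)%O ->
  \sum_(k < (rank y).+1) (-1) ^+ k * #|` level \bot y k|%:R = 0 :> int.
Proof.
move=> y0; rewrite -(sum_sign_rank y0).
(* The truncation by [inord] is harmless, as no rank in the interval exceeds [rank y]. *)
rewrite [RHS]big_seq (partition_big (fun z => inord (rank z) : 'I_(rank y).+1) xpredT)//=.
apply: eq_bigr => k _.
rewrite card_fset_sum1 natr_sum mulr_sumr /level big_fset /= [LHS]big_seq_cond.
apply: eq_big => [z|z /andP[_ /eqP ->]]; last by rewrite mulr1.
have [|//] := boolP (z \in itv \bot y); rewrite in_fitv// => /andP[_ zy] /=.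
by apply/eqP/eqP => [rz|<-]; rewrite ?rz ?inord_val// inordK// ltnS rank_le.
Qed.

End EulerRelation.

Section Isomorphisms.
Context {d : Order.disp_t} {P : bPOrderType d}.
Implicit Types (x y z p c : P).
Local Open Scope order_scope.

Hypotheses (lf : locally_finite P) (gr : graded_intervals P).
Variable D : nat -> nat.
Hypothesis hF : forall x y, x != \bot -> factorial_interval x y.
Hypothesis hD : forall y, y != \bot -> nb_max_chains \bot y = D (rank y).
Hypothesis hR : forall r : nat, exists y : P, rank y = r.

Let neq_bot y : (0 < rank y)%N = (y != \bot).
Proof. by rewrite lt0n (rank_eq0 lf gr). Qed.

(** The minimum contributes the constant term 1 of the Euler relation. The other terms share the
    factor [natoms D N.+1], and dividing by it leaves the binomial transform. *)
Lemma self_inverse_natoms : eulerian P ->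
  self_inverse (fun j => (natoms D j.+1)%:R^-1)%R.
Proof.
move=> eul N; have [y ry] := hR N.+1.
have y0 : y != \bot by rewrite -neq_bot ry.
have := euler_relation lf gr eul (y := y); rewrite lt0x => /(_ y0).
rewrite ry big_ord_recl expr0 mul1r => /(congr1 (fun i : int => i%:~R%R : rat)).
have -> : level \bot y 0 = [fset \bot]%fset.
  apply/fsetP => z; rewrite in_level// le0x in_fset1 (rank_eq0 lf gr).
  by case: eqP => [->|_]; rewrite ?le0x ?andbF.
rewrite cardfs1 rmorphD rmorph1 rmorph_sum rmorph0 /= => E.
have a0 : ((natoms D N.+1)%:R != 0 :> rat)%R.
  by rewrite pnatr_eq0 -lt0n (natoms_gt0 lf gr hF hD hR).
apply: (mulfI a0); rewrite mulfV//; move/eqP: E; rewrite addr_eq0 => /eqP E; rewrite [LHS]E {E}.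
rewrite mulr_sumr -sumrN; apply: eq_bigr => j _.
have aj : ((natoms D j.+1)%:R != 0 :> rat)%R.
  by rewrite pnatr_eq0 -lt0n (natoms_gt0 lf gr hF hD hR).
have := card_level_natoms lf gr hF hD hR (y := y) (k := j.+1).
rewrite ry /= ltn_ord => /(_ isT) /(congr1 (fun n => n%:R : rat)%R).
rewrite !natrM => E.
rewrite rmorphM rmorphXn rmorphN1 /= /bump /= add1n exprS mulN1r mulNr opprK.
have -> : (#|` level \bot y j.+1|%:R%:~R =
    (natoms D N.+1)%:R * 'C(N, j)%:R / (natoms D j.+1)%:R :> rat)%R.
  by rewrite -E mulfK// natz.
by rewrite -!mulrA mulrCA.
Qed.

(** * Isomorphism types of Sheffer intervals *)

(** An element of rank at least 2 has two atoms, hence lies above both atoms [a] and [b] of [y].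
    Such elements are the nonminimal ones of the Boolean interval [[a, y]] and go to nonempty sets;
    this leaves the empty set for [\bot], while [a] and [b] become the two added elements. *)
Lemma suspension_interval_iso y n : (forall k, (1 < k)%N -> natoms D k = 2%N) ->
  rank y = n.+2 -> interval_iso \bot y (dual_suspension {set 'I_n.+1}).
Proof.
move=> two ry; have y0 : y != \bot by rewrite -neq_bot ry.
have A2 : #|` atoms \bot y| = 2%N.
  by rewrite (card_atoms_sheffer lf gr hF hD hR)// ry two.
have [a aA] : exists a, a \in atoms \bot y by apply/fset0Pn; rewrite -cardfs_gt0 A2.
have [b] : exists b, b \in (atoms \bot y `\ a)%fset.
  apply/fset0Pn; rewrite -cardfs_gt0.
  by have := cardfsD1 a (atoms \bot y); rewrite aA A2; lia.
rewrite in_fsetD1 => /andP[ba bA].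
have abE p : p \in atoms \bot y -> (p == a) || (p == b).
  suff <- : [fset a; b]%fset = atoms \bot y by rewrite in_fset2.
  apply: fset_eqEcard; last by rewrite cardfs2 eq_sym ba A2.
  by apply/fsubsetP => q; rewrite in_fset2 => /orP[]/eqP->.
have := aA; have := bA; rewrite !(in_atoms_bot lf gr).
move=> /andP[b_y /eqP rb] /andP[a_y /eqP ra].
have a0 : a != \bot by rewrite -neq_bot ra.
have b0 : b != \bot by rewrite -neq_bot rb.
have above z : z <= y -> (1 < rank z)%N -> (a < z) && (b < z).
  move=> zy rz; have z0 : z != \bot by rewrite -neq_bot; lia.
  have /fsetP AE : atoms \bot z = atoms \bot y.
    apply: fset_eqEcard; first exact: atoms_mono.
    by rewrite A2 (card_atoms_sheffer lf gr hF hD hR)// two.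
  have := AE a; have := AE b; rewrite aA bA !(in_atoms_bot lf gr) ra rb !andbT.
  move=> bz az; rewrite !lt_neqAle az bz !andbT.
  by apply/andP; split; apply/eqP => E; rewrite -E ?ra ?rb in rz.
have low z : z <= y -> (rank z <= 1)%N -> [|| z == \bot, z == a | z == b].
  move=> zy; rewrite leq_eqVlt ltnS leqn0 (rank_eq0 lf gr) => /orP[rz|->//].
  by rewrite abE ?orbT// (in_atoms_bot lf gr) zy.
have fa := hF a0 (y := y); have rn : (rank y - rank a = n.+1)%N by rewrite ry ra subn1.
pose h := coatoms_missing a y n.+1.
have hM z w : a <= z -> z <= y -> a <= w -> w <= y -> (h z \subset h w) = (z <= w).
  move=> az zy aw wy; apply: (coatoms_missing_mono lf gr fa a_y rn).
    by rewrite in_fitv// az zy.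
  by rewrite in_fitv// aw wy.
have h0 z : a <= z -> z <= y -> (h z == finset.set0) = (z == a).
  move=> az zy; have ha : h a = finset.set0.
    apply/eqP; rewrite -finset.subset0; apply/fintype.subsetP => i.
    rewrite inE; have : enum_coatom a y i \in coatoms a y.
      by apply/(enum_coatomP lf gr fa a_y rn); exists i.
    by rewrite in_coatoms// => /andP[/andP[->]].
  by rewrite -ha finset.eqEsubset !hM// eq_le.
pose g z : dual_suspension {set 'I_n.+1} :=
  if z == \bot then inl finset.set0 else
  if z == a then inr true else if z == b then inr false else inl (h z).
have gE z : (1 < rank z)%N -> g z = inl (h z).
  rewrite /g => rz; have [zE|_] := eqVneq z \bot.
    by rewrite zE (rank_bot lf gr) in rz.
  have [zE|_] := eqVneq z a; first by rewrite zE ra in rz.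
  by have [zE|//] := eqVneq z b; rewrite zE rb in rz.
have g_bot : g \bot = inl finset.set0 by rewrite /g eqxx.
have ga : g a = inr true by rewrite /g (negPf a0) eqxx.
have gb : g b = inr false by rewrite /g (negPf b0) (negPf ba) eqxx.
have ab : (a <= b) = false.
  by apply/negP => /(rank_inj lf gr); rewrite ra rb => /(_ isT) E; rewrite E eqxx in ba.
have ba' : (b <= a) = false.
  by apply/negP => /(rank_inj lf gr); rewrite ra rb => /(_ isT) E; rewrite E eqxx in ba.
have leE (u v : dual_suspension {set 'I_n.+1}) : (u <= v) = dual_suspension_le u v.
  by [].
apply: (interval_iso_of_inverse (g := g)) => // [z w|[S|i]].
- rewrite !in_fitv// !le0x /= => zy wy; rewrite leE.
  have [rz|/(low _ zy)/or3P[]/eqP->] := ltnP 1 (rank z).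
  + have /andP[az bz] := above z zy rz; rewrite (gE z rz).
    have hz0 : (h z == finset.set0) = false by rewrite h0 ?(ltW az)// gt_eqF.
    have [rw|/(low _ wy)/or3P[]/eqP->] := ltnP 1 (rank w).
    * have /andP[aw bw] := above w wy rw; rewrite (gE w rw) /= leEset.
      by apply: hM => //; exact: ltW.
    * rewrite g_bot /= leEset finset.subset0 hz0; apply/esym/negbTE.
      by rewrite lex0 -neq_bot (ltn_trans _ rz).
    * by rewrite ga /= hz0; apply/esym/negbTE; rewrite lt_geF.
    * by rewrite gb /= hz0; apply/esym/negbTE; rewrite lt_geF.
  + rewrite g_bot le0x; have [rw|/(low _ wy)/or3P[]/eqP->] := ltnP 1 (rank w).
    * by rewrite (gE w rw) /= leEset finset.sub0set.
    * by rewrite g_bot /= lexx.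
    * by rewrite ga /= eqxx.
    * by rewrite gb /= eqxx.
  + rewrite ga; have [rw|/(low _ wy)/or3P[]/eqP->] := ltnP 1 (rank w).
    * have /andP[aw bw] := above w wy rw; rewrite (gE w rw) /= (ltW aw) lt0x.
      by rewrite h0 ?(ltW aw)// gt_eqF.
    * by rewrite g_bot /= ltxx lex0 (negPf a0).
    * by rewrite ga /= lexx.
    * by rewrite gb /= ab.
  + rewrite gb; have [rw|/(low _ wy)/or3P[]/eqP->] := ltnP 1 (rank w).
    * have /andP[aw bw] := above w wy rw; rewrite (gE w rw) /= (ltW bw) lt0x.
      by rewrite h0 ?(ltW aw)// gt_eqF.
    * by rewrite g_bot /= ltxx lex0 (negPf b0).
    * by rewrite ga /= ba'.
    * by rewrite gb /= lexx.
- have [->|S0] := eqVneq S finset.set0; first by exists \bot; rewrite ?le0x.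
  have [z /andP[az zy] hz] := coatoms_missing_surj lf gr fa a_y rn S.
  exists z; first by rewrite le0x zy.
  rewrite gE ?/h ?hz//.
  have : a < z by rewrite lt_neqAle az andbT eq_sym -h0// /h hz.
  by move/(rank_lt lf gr); rewrite ra.
- by exists (if i then a else b); case: i; rewrite ?le0x ?ga ?gb.
Qed.

End Isomorphisms.

(** * Cubical lattices *)

Section CubeIso.
Context {d : Order.disp_t} {P : bPOrderType d}.
Implicit Types (x y z p q c : P).
Local Open Scope order_scope.

Hypotheses (lf : locally_finite P) (gr : graded_intervals P).
Variable D : nat -> nat.
Hypothesis hF : forall x y, x != \bot -> factorial_interval x y.
Hypothesis hD : forall y, y != \bot -> nb_max_chains \bot y = D (rank y).
Hypothesis hR : forall r : nat, exists y : P, rank y = r.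
Hypothesis natoms_pow2 : forall n, natoms D n.+1 = (2 ^ n)%N.

Let neq_bot y : (0 < rank y)%N = (y != \bot).
Proof. by rewrite lt0n (rank_eq0 lf gr). Qed.

(** Since [natoms D n.+2] is twice [natoms D n.+1], [card_common_atoms] does not apply. In a lattice
    the common atoms are those of the meet [m]; a common atom provides an element of corank 2 below
    both coatoms, so that [m] has corank 2. *)
Lemma card_common_atoms_lattice y c c' n : interval_lattice \bot y ->
  rank y = n.+3 -> c \in coatoms \bot y -> c' \in coatoms \bot y -> c != c' ->
  (atoms \bot c `&` atoms \bot c')%fset != fset0 ->
  #|` (atoms \bot c `&` atoms \bot c')%fset| = (2 ^ n)%N.
Proof.
move=> lat ry cC c'C cc'; have := cC; have := c'C.
rewrite !(in_coatoms_bot lf) ry !eqSS => /andP[c'y /eqP rc'] /andP[cy /eqP rc].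
have [||m mI mE] := (lat c c' _ _).2; rewrite ?le0x ?cy ?c'y//.
case/fset0Pn => p; rewrite in_fsetI !(in_atoms_bot lf gr).
move=> /andP[/andP[pc /eqP rp] /andP[pc' _]].
have p0 : p != \bot by rewrite -neq_bot rp.
have [||z [/andP[pz zy] zc zc' rz _]] := coatoms_pair lf gr (hF p0 (y := y)) _ _ cc'.
- by rewrite in_coatoms// pc cy rc ry/=.
- by rewrite in_coatoms// pc' c'y rc' ry/=.
have my : m <= y by case/andP: mI.
have mc : m <= c by have := mE m; rewrite le0x my lexx => /(_ isT)/esym/andP[].
have mc' : m <= c' by have := mE m; rewrite le0x my lexx => /(_ isT)/esym/andP[].
have zm : z <= m by rewrite mE ?zc// le0x.
have rm : rank m = n.+1.
  have := rank_le lf gr zm; have := rank_le lf gr mc; rewrite rc.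
  rewrite leq_eqVlt => /orP[/eqP rmc|]; last first.
    by move: rz; rewrite ry ltnS => -[<-] le1 le2; apply/eqP; rewrite eqn_leq le1.
  case/eqP: cc'; have E : m = c by apply: (rank_inj lf gr mc); rewrite rc rmc.
  by apply: (rank_inj lf gr); rewrite ?rc ?rc'// -E.
have -> : (atoms \bot c `&` atoms \bot c')%fset = atoms \bot m.
  apply/fsetP => q; rewrite in_fsetI !(in_atoms_bot lf gr) andbACA andbb.
  congr (_ && _); have [qy|qy] := boolP (q <= y); first by rewrite mE// le0x.
  apply/idP/idP => [/andP[qc _]|qm]; case/negP: qy; first exact: le_trans cy.
  exact: le_trans my.
by rewrite (card_atoms_sheffer lf gr hF hD hR) -?neq_bot ?rm.
Qed.

(** There are [2 n + 1] other coatoms, and the incidence count shows that [2 n] of them meet [c].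
    The remaining one has half of the atoms, as [c] does, so its atoms are the complement of those
    of [c]. *)
Lemma opposite_coatom y c n : interval_lattice \bot y ->
  rank y = n.+2 -> c \in coatoms \bot y ->
  exists c', [/\ c' \in coatoms \bot y,
    forall q, q \in atoms \bot y -> (q <= c') = ~~ (q <= c) &
    forall w, w \in coatoms \bot y ->
      (forall q, q \in atoms \bot y -> ~~ ((q <= c) && (q <= w))) -> w = c'].
Proof.
move=> lat ry cC; have y0 : y != \bot by rewrite -neq_bot ry.
have cardC : #|` coatoms \bot y| = (2 * n.+1)%N.
  have := card_coatoms_sheffer lf gr hF hD hR ry; rewrite !natoms_pow2 => /eqP.
  by rewrite expnS -mulnA (mulnC (2 ^ n)) mulnA eqn_pmul2r ?expn_gt0// => /eqP.
pose I c' := (atoms \bot c `&` atoms \bot c')%fset.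
pose Y := [fset c' in coatoms \bot y `\ c | I c' == fset0]%fset.
have cardK : (\sum_(c' <- (coatoms \bot y `\ c)%fset) (I c' != fset0) = 2 * n)%N.
  have := sum_common_atoms lf gr hF hD hR ry cC; rewrite natoms_pow2.
  (* In rank 2 distinct coatoms share no atom, and the count of common atoms for lattices starts at
     rank 3. *)
  case: n {cardC} ry => [ry|n ry].
    rewrite muln0 => /eqP; rewrite sum_nat_seq_eq0 => /allP I0.
    apply/eqP; rewrite sum_nat_seq_eq0; apply/allP => c' /I0 /=.
    by rewrite cardfs_eq0 => ->.
  rewrite (_ : \sum_(c' <- _) _ =
    (\sum_(c' <- (coatoms \bot y `\ c)%fset) (I c' != fset0)) * 2 ^ n)%N.
    by rewrite expnS mulnAC => /eqP; rewrite eqn_pmul2r ?expn_gt0// => /eqP.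
  rewrite big_distrl /= big_seq [RHS]big_seq; apply: eq_bigr => c'.
  rewrite in_fsetD1 eq_sym => /andP[cc' c'C].
  have [I0|I0] := eqVneq (I c') fset0; first by rewrite -/(I c') I0 cardfs0.
  by rewrite mul1n (card_common_atoms_lattice lat ry).
have : #|` Y| = 1%N.
  have := cardfsD1 c (coatoms \bot y); rewrite cC cardC.
  have : (#|` Y| + 2 * n = #|` (coatoms \bot y `\ c)%fset|)%N.
    rewrite -cardK card_fset_filter -big_split card_fset_sum1.
    by apply: eq_bigr => c' _; case: (I c' == fset0).
  by lia.
move/eqP/cardfs1P => [c' YE].
have : c' \in Y by rewrite YE in_fset1.
rewrite in_fset_filter in_fsetD1 => /andP[/andP[c'c c'C] /eqP I0].
have disj q : q \in atoms \bot y -> ~~ ((q <= c) && (q <= c')).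
  rewrite (in_atoms_bot lf gr) => /andP[_ rq]; apply/negP => /andP[qc qc'].
  by have /fsetP/(_ q) := I0; rewrite in_fsetI !(in_atoms_bot lf gr) qc qc' rq.
have sub w : w \in coatoms \bot y -> (atoms \bot w `<=` atoms \bot y)%fset.
  by rewrite (in_coatoms_bot lf) => /andP[wy _]; exact: atoms_mono.
have UE : (atoms \bot c `|` atoms \bot c')%fset = atoms \bot y.
  apply: fset_eqEcard; first by rewrite fsubUset !sub.
  rewrite (card_atoms_sheffer lf gr hF hD hR)// cardfsU -/(I c') I0 cardfs0.
  rewrite !(card_atoms_coatom lf gr hF hD hR ry)// ry !natoms_pow2 expnS.
  by lia.
exists c'; split=> //.
  move=> q qA; have /fsetP/(_ q) := UE; have := disj _ qA.
  have rq : rank q == 1%N by move: qA; rewrite (in_atoms_bot lf gr) => /andP[].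
  rewrite in_fsetU !(in_atoms_bot lf gr) rq !andbT.
  move: qA; rewrite (in_atoms_bot lf gr) => /andP[-> _].
  by case: (q <= c); case: (q <= c').
move=> w wC wdisj; suff : w \in Y by rewrite YE in_fset1 => /eqP.
rewrite in_fset_filter in_fsetD1 wC andbT; apply/andP; split.
  apply/eqP => wc; have : (0 < #|` atoms \bot w|)%N.
    by rewrite (card_atoms_coatom lf gr hF hD hR ry wC) natoms_pow2 expn_gt0.
  rewrite cardfs_gt0 => /fset0Pn[q qw].
  have /wdisj/negP[] := fsubsetP (sub _ wC) _ qw.
  by move: qw; rewrite (in_atoms_bot lf gr) -wc => /andP[->].
apply/eqP/fsetP => q; rewrite inE; apply/negP; rewrite in_fsetI => /andP[qc qw].
have /wdisj/negP[] := fsubsetP (sub _ wC) _ qw.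
by move: qc qw; rewrite !(in_atoms_bot lf gr) => /andP[-> _] /andP[->].
Qed.

(* In a lattice the coatoms above [z] and [z'] that lie above [z'] are those
   above the join, so [z'] equals the join. *)
Lemma lattice_coatoms_le y z z' : interval_lattice \bot y ->
  z <= y -> z' <= y -> z' != \bot ->
  (coatoms z' y `<=` coatoms z y)%fset -> z <= z'.
Proof.
move=> lat zy z'y z'0 sub.
have [||] := (lat z z' _ _).1; rewrite ?le0x ?zy ?z'y// => j /andP[_ jy] jE.
have := jE j; rewrite le0x jy lexx => /(_ isT)/esym/andP[zj z'j].
suff <- : j = z' by [].
apply: (coatoms_inj lf gr (hF z'0 (y := y))); rewrite ?z'j ?lexx//.
apply/fsetP => c; apply/idP/idP; first exact: fsubsetP (coatoms_anti lf y z'j) c.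
move=> cz'; have := fsubsetP sub _ cz'; move: cz'.
rewrite !in_coatoms// => /andP[/andP[z'c cy] rc] /andP[/andP[zc _] _].
by rewrite jE ?le0x ?cy// zc z'c rc.
Qed.

Lemma atom_below z : z != \bot -> exists2 q, q \in atoms \bot z & q <= z.
Proof.
move=> z0; have : (0 < #|` atoms \bot z|)%N.
  rewrite (card_atoms_sheffer lf gr hF hD hR)//.
  by apply: (natoms_gt0 lf gr hF hD hR); rewrite neq_bot.
rewrite cardfs_gt0 => /fset0Pn[q qz]; exists q => //.
by move: qz; rewrite (in_atoms_bot lf gr) => /andP[].
Qed.

Section Coordinates.
Variables (y : P) (n : nat).
Hypotheses (ry : rank y = n.+1) (lat : interval_lattice \bot y).

(* The facets of a cube come in opposite pairs; [facet i false] runs through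
   the facets containing a fixed vertex. *)
Lemma facets_ex : exists facet : 'I_n -> bool -> P,
  [/\ forall i b, facet i b \in coatoms \bot y,
      forall i q, q \in atoms \bot y -> (q <= facet i true) = ~~ (q <= facet i false),
      forall c, c \in coatoms \bot y -> c != \bot -> exists i b, c = facet i b &
      forall i j b b', facet i b = facet j b' -> i = j].
Proof.
have y0 : y != \bot by rewrite -neq_bot ry.
have [p pA py] := atom_below y0.
have := pA; rewrite (in_atoms_bot lf gr) => /andP[_ /eqP rp].
have p0 : p != \bot by rewrite -neq_bot rp.
have fp := hF p0 (y := y); have rn : (rank y - rank p = n)%N by rewrite ry rp subn1.
have enumC i : enum_coatom p y (n := n) i \in coatoms \bot y.
  apply: (fsubsetP (coatoms_anti lf y (le0x p))).
  by apply/(enum_coatomP lf gr fp py rn); exists i.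
have enum_ge i : p <= enum_coatom p y (n := n) i.
  have : enum_coatom p y i \in coatoms p y.
    by apply/(enum_coatomP lf gr fp py rn); exists i.
  by rewrite in_coatoms// => /andP[/andP[]].
have enum_inj : injective (enum_coatom p y (n := n)) by exact: enum_coatom_inj.
move: (enum_coatomP lf gr fp py rn) enumC enum_ge enum_inj.
move: (enum_coatom p y (n := n)) => e eP eC e_ge e_inj.
have /choice[o oP] : forall i : 'I_n, exists c', [/\ c' \in coatoms \bot y,
    forall q, q \in atoms \bot y -> (q <= c') = ~~ (q <= e i) &
    forall w, w \in coatoms \bot y ->
      (forall q, q \in atoms \bot y -> ~~ ((q <= e i) && (q <= w))) -> w = c'].
  (* Opposite coatoms exist from rank 2 on; in rank 1 there is no index [i]. *)
  move=> i; case: n ry e eP eC e_ge e_inj i => [|m] ry' e' _ eC' _ _ i.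
    by case: i.
  exact: opposite_coatom lat ry' (eC' i).
exists (fun i b => if b then o i else e i); split.
- by move=> i [] //; have [] := oP i.
- by move=> i q qA; have [_ -> ] := oP i.
(* Rank 1 is ruled out by [c != \bot], since the minimum is then the only coatom. *)
- move=> c cC c0; have [m rym] : exists m, rank y = m.+2.
    move: cC; rewrite (in_coatoms_bot lf) => /andP[_ /eqP <-].
    by exists (rank c).-1; rewrite prednK// neq_bot.
  have [pc|pc] := boolP (p <= c).
    have /eP[i ->] : c \in coatoms p y.
      by move: cC; rewrite (in_coatoms_bot lf) in_coatoms// pc.
    by exists i, false.
  (* A coatom that does not contain [p] has an opposite that does, and is recovered from it by the
     uniqueness of opposites. *)
  have [c' [c'C c'E _]] := opposite_coatom lat rym cC.
  have /eP[i c'i] : c' \in coatoms p y.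
    move: c'C; rewrite (in_coatoms_bot lf) in_coatoms// => /andP[-> ->].
    by rewrite c'E// pc.
  exists i, true; have [_ _] := oP i; apply=> // q qA.
  by rewrite -c'i c'E// andNb.
- have pe i : (p <= o i) = false by have [_ -> // _] := oP i; rewrite e_ge.
  move=> i j [] [] //.
  + move=> oo; have [_ oi _] := oP i; have [_ oj _] := oP j.
    have [m rym] : exists m, rank y = m.+2.
      by move: i {oo oi}; rewrite ry; case: n => [[]//|m] _; exists m.
    apply: e_inj; have [oiC _ _] := oP i.
    have [c' [_ _ c'u]] := opposite_coatom lat rym oiC.
    transitivity c'; [|apply/esym]; apply: c'u (eC _) _ => q qA.
      by rewrite oi// andNb.
    by rewrite oo oj// andNb.
  + by move=> E; have := e_ge j; rewrite -E pe.
  + by move=> E; have := e_ge i; rewrite E pe.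
  + exact: e_inj.
Qed.

(** The coordinate [i] of [z] tells which of the two opposite facets lies above [z], and is [None]
    if neither does; both cannot, by looking at an atom below [z]. The coordinates thus record the
    coatoms above [z], which determine the order. *)
Lemma cube_interval_iso : interval_iso \bot y (cubical_lattice n.+1).
Proof.
have [facet [fC fopp fsurj finj]] := facets_ex.
have y0 : y != \bot by rewrite -neq_bot ry.
have f_y i b : facet i b <= y by have := fC i b; rewrite (in_coatoms_bot lf) => /andP[].
have rf i b : (rank (facet i b)).+1 = rank y.
  by have := fC i b; rewrite (in_coatoms_bot lf) => /andP[_ /eqP].
have atomsS z q : z <= y -> q \in atoms \bot z -> q \in atoms \bot y.
  by move=> zy; exact: fsubsetP (atoms_mono lf \bot zy) q.
have facetN z i b : z <= y -> z != \bot -> z <= facet i b -> z <= facet i (~~ b) -> false.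
  move=> zy z0 z1 z2; have [q qz qz'] := atom_below z0.
  have := fopp i q (atomsS _ _ zy qz); move: z1 z2; case: b => /= z1 z2.
    by rewrite (le_trans qz' z1) (le_trans qz' z2).
  by rewrite (le_trans qz' z1) (le_trans qz' z2).
have coatomsP z c : z <= y -> z != \bot -> c \in coatoms z y ->
    exists i b, c = facet i b.
  move=> zy z0 cz; apply: fsurj; first exact: fsubsetP (coatoms_anti lf y (le0x z)) _ cz.
  by move: cz; rewrite in_coatoms// => /andP[/andP[zc _] _]; rewrite -lt0x (lt_le_trans _ zc)// lt0x.
pose phi z : {ffun 'I_n -> option bool} := [ffun i =>
  if z <= facet i false then Some false
  else if z <= facet i true then Some true else None].
have phiP z i b : z <= y -> z != \bot -> (phi z i == Some b) = (z <= facet i b).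
  move=> zy z0; rewrite ffunE; have := facetN z i b zy z0.
  case: b => /=; case: (z <= facet i true); case: (z <= facet i false) => //=.
  by move=> /(_ isT isT).
pose g z : cubical_lattice n.+1 := if z == \bot then None else Some (phi z).
have leE (u v : cubical_lattice n.+1) : (u <= v) = cubical_le u v by [].
have phi_le z w : z <= y -> w <= y -> z != \bot -> w != \bot ->
    [forall i, cube_coord_le (phi z i) (phi w i)] = (z <= w).
  move=> zy wy z0 w0; apply/forallP/idP => [H|zw i].
    apply: (lattice_coatoms_le lat zy wy w0); apply/fsubsetP => c cw.
    have [i [b cE]] := coatomsP _ _ wy w0 cw.
    move: cw; rewrite cE !in_coatoms// rf f_y eqxx !andbT -!phiP// => /eqP pw.
    by have := H i; rewrite /cube_coord_le pw orbF.
  rewrite /cube_coord_le; case E: (phi w i) => [b|]; last by rewrite orbT.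
  by rewrite orbF phiP// (le_trans zw)// -phiP// E.
(* The map from atoms to sign vectors is injective, and there are [2 ^ n] of each. *)
have vertex (f : {ffun 'I_n -> bool}) : exists2 q, q \in atoms \bot y &
    forall i, q <= facet i (f i).
  pose psi q : {ffun 'I_n -> bool} := [ffun i => ~~ (q <= facet i false)].
  have psiP q i : q \in atoms \bot y -> q <= facet i (psi q i).
    move=> qA; rewrite ffunE; case: (boolP (q <= facet i false)) => //= nq.
    by rewrite fopp.
  have psi_inj : {in atoms \bot y &, injective psi}.
    move=> q q' qA q'A E.
    have := qA; have := q'A; rewrite !(in_atoms_bot lf gr).
    move=> /andP[q'y /eqP rq'] /andP[qy /eqP rq].
    have q0 : q != \bot by rewrite -neq_bot rq.
    have q'0 : q' != \bot by rewrite -neq_bot rq'.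
    apply: (rank_inj lf gr); last by rewrite rq rq'.
    rewrite -phi_le//; apply/forallP => i; rewrite /cube_coord_le.
    have /eqP -> : phi q i == Some (psi q i) by rewrite phiP// psiP.
    have /eqP -> : phi q' i == Some (psi q' i) by rewrite phiP// psiP.
    by rewrite E eqxx.
  have cardI : #|` [fset psi q | q in atoms \bot y]%fset| = (2 ^ n)%N.
    rewrite card_in_imfset//= (card_atoms_sheffer lf gr hF hD hR)// ry.
    exact: natoms_pow2.
  have : f \in [fset psi q | q in atoms \bot y]%fset.
    suff -> : [fset psi q | q in atoms \bot y]%fset =
      [fset h in {: {ffun 'I_n -> bool}}]%fset by rewrite inE.
    apply: fset_eqEcard; first by apply/fsubsetP => h _; rewrite inE.
    by rewrite card_finset cardI cardT -cardE card_ffun card_bool card_ord.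
  by move=> /imfsetP[q /= qA ->]; exists q => // i; exact: psiP.
apply: (interval_iso_of_inverse (g := g)) lf _ => [z w|].
  rewrite !in_fitv// !le0x /= => zy wy; rewrite leE /g.
  have [->|z0] := eqVneq z \bot; first by rewrite le0x.
  have [->|w0] := eqVneq w \bot; first by rewrite lex0 (negPf z0).
  by rewrite /= phi_le.
move=> [f|]; last by exists \bot; rewrite ?le0x// /g eqxx.
(* Any vertex of the prescribed face will do, so free coordinates are set to [false]. In the Boolean
   interval above [q], the wanted element is the one whose coatoms are the facets given by the fixed
   coordinates. *)
have [q qA qf] := vertex [ffun i => odflt false (f i)].
have := qA; rewrite (in_atoms_bot lf gr) => /andP[qy /eqP rq].
have q0 : q != \bot by rewrite -neq_bot rq.
pose S := [fset c in coatoms q y | [exists i, (f i != None) &&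
  (c == facet i (odflt false (f i)))]]%fset.
have [||z /andP[qz zy] zS] := coatoms_surj lf gr (hF q0 (y := y)) (S := S).
- exact: qy.
- by apply/fsubsetP => c; rewrite in_fset_filter => /andP[].
have z0 : z != \bot by rewrite -lt0x (lt_le_trans _ qz)// lt0x.
exists z; first by rewrite le0x.
rewrite /g (negPf z0); congr Some; apply/ffunP => i.
have zf j b : (z <= facet j b) = (facet j b \in S).
  by rewrite -zS in_coatoms// f_y rf eqxx !andbT.
case fi: (f i) => [b|].
  apply/eqP; rewrite phiP// zf in_fset_filter in_coatoms// f_y rf eqxx.
  have := qf i; rewrite ffunE fi /= => -> /=.
  by apply/existsP; exists i; rewrite fi /=.
case E: (phi z i) => [b|//]; move/eqP: E; rewrite phiP// zf in_fset_filter.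
move=> /andP[_ /existsP[j /andP[fj /eqP/finj ij]]].
by rewrite -ij fi in fj.
Qed.

End Coordinates.
End CubeIso.

(** * Trichotomy by the number of atoms of a 3-interval *)

Theorem theorem4p1 (d : Order.disp_t) (P : bPOrderType d) (B D : nat -> nat)
    (hSheffer : sheffer_poset P) (hEulerian : eulerian P)
    (hB : is_binomial_factorial P B) (hD : is_sheffer_factorial P D)
    (hBfact : forall n : nat, B n = n`!) :
  [\/ [/\ forall n : nat, 2 <= n -> D n = 2 * (n.-1)`!
        & forall (n : nat) (y : P), 2 <= n -> n_interval n \bot%O y ->
            interval_iso \bot%O y (dual_suspension {set 'I_n.-1})],
      [/\ forall n : nat, 1 <= n -> D n = n`!,
          binomial_poset P
        & forall (n : nat) (y : P), n_interval n \bot%O y ->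
            interval_iso \bot%O y {set 'I_n}]
    | [/\ forall n : nat, 1 <= n -> D n = 2 ^ n.-1 * (n.-1)`!
        & forall (n : nat) (y : P), 1 <= n -> n_interval n \bot%O y ->
            interval_lattice \bot%O y ->
            interval_iso \bot%O y (cubical_lattice n)]].
Proof.
have [lf inf gr _ _] := hSheffer.
have rank_bot0 := rank_bot lf gr.
have hF (x y : P) : x != \bot%O -> factorial_interval x y.
  move=> x0 s t xs st _; have s0 : s != \bot%O.
    by rewrite -lt0x (lt_le_trans _ xs)// lt0x.
  by rewrite (hB _ _ _ s0 (conj st erefl)) hBfact.
have rankE n (y : P) : n_interval n \bot%O y -> rank y = n.
  by move=> [_]; rewrite rank_bot0 subn0.
have hD' (y : P) : y != \bot%O -> nb_max_chains \bot%O y = D (rank y).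
  by move=> y0; apply: hD => //; split; rewrite ?le0x// rank_bot0 subn0.
have hR r : exists y : P, rank y = r by exact: rank_surj.
have sv := self_inverse_natoms lf gr hF hD' hR hEulerian.
have a1 := natoms1 lf gr hD' hR.
have a_gt0 := natoms_gt0 lf gr hF hD' hR.
have a_mono := natoms_mono lf gr hF hD' hR.
have a_coatoms n : exists C, C * natoms D n.+1 = natoms D n.+2 * n.+1.
  have [y ry] := hR n.+2; exists #|` coatoms \bot%O y|.
  exact: (card_coatoms_sheffer lf gr hF hD' hR ry).
have a_lower := natoms_lower lf gr hF hD' hR.
have a_neq3 := natoms_neq3 lf gr hF hD' hR.
have a_simplex := natoms_simplex lf gr hF hD' hR.
have DE := shefferE lf gr hF hD' hR.
have := natoms3 sv a1 a_gt0 a_mono a_coatoms.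
move E : (natoms D 3) => a3.
case: a3 E => [|[|[|[|[|a3]]]]]// E _.
- have two := natoms_suspension sv a1 a_gt0 a_mono a_neq3 E.
  constructor 1; split=> [n n2|n y n2 /rankE ry]; first by rewrite DE ?two// ltnW.
  case: n n2 ry => [|[|n]]// _ ry.
  exact: (suspension_interval_iso lf gr hF hD' hR two ry).
- have aE := natoms_simplex_all sv a1 a_gt0 a_simplex E.
  have Dfact n : 1 <= n -> D n = n`!.
    by move=> n1; rewrite DE// aE//; case: n n1.
  have fact (x y : P) : factorial_interval x y.
    move=> s t _ st _; have [s0|/hF fs] := eqVneq s \bot%O; last first.
      by apply: fs => //; exact: lexx.
    (* The value [D 0] is unconstrained, so the trivial interval at the minimum is counted
       directly. *)
    have [t0|t0] := eqVneq t \bot%O.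
      by rewrite s0 t0 nb_max_chains_refl// subnn.
    by rewrite s0 hD'// rank_bot0 subn0 Dfact// lt0n (rank_eq0 lf gr).
  constructor 2; split=> //.
    split=> // n x y u v [xy <-] [uv] rn.
    by rewrite (fact x y x y)// (fact u v u v)// rn.
  move=> n y /rankE ry.
  by apply: (factorial_interval_iso lf gr); rewrite ?le0x ?rank_bot0 ?subn0.
- have aE := natoms_cube sv a1 a_gt0 a_mono a_coatoms a_lower E.
  constructor 3; split=> [n n1|n y n1 /rankE ry lat]; first by rewrite DE ?aE.
  case: n n1 ry => // n _ ry.
  exact: (cube_interval_iso lf gr hF hD' hR (fun k => aE k.+1 isT) ry lat).
Qed.
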